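(* Let $\bar A=(A_0,A_1)$ be a compatible couple of (quasi-)Banach spaces with $A_0\cap A_1\neq\{0\}$. Let $0<\theta_0<1$, $0<\theta\le1$, $0<q_0,r,r_0\le\infty$, $a,a_0,b_0\in SV$, and $\left\|s^{-1/r_0}\frac{b_0(s)}{a_0(s)}\right\|_{r_0,(0,1)}<\infty$. If $\theta=1$, assume additionally that $\left\|s^{-1/r}a(s)\right\|_{r,(0,1)}<\infty$. Put $c_0(t)=a_0(t)\left\|s^{-1/r_0}\frac{b_0(s)}{a_0(s)}\right\|_{r_0,(0,t)}$ and $\rho(t)=t^{1-\theta_0}c_0(t)$ for $t>0$. Then $$\left(\bar A^{\mathcal R}_{\theta_0,r_0,b_0,q_0,a_0},A_1\right)_{\theta,r,a}\cong\bar A_{\eta,r,a^{\#}},$$ where $\eta=(1-\theta)\theta_0+\theta$ and $a^{\#}(t)=c_0(t)^{1-\theta}a(\rho(t))$.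
   Context: For a compatible couple $\bar X=(X_0,X_1)$ of (quasi-)Banach spaces, $f\in X_0+X_1$ and $t>0$, $K(t,f)=K(t,f;\bar X)=\inf\{\|f_0\|_{X_0}+t\|f_1\|_{X_1}: f=f_0+f_1,\ f_i\in X_i\}$. $\|\cdot\|_{q,(c,d)}$ ($0<q\le\infty$) is the usual (quasi-)norm of the Lebesgue space $L_q$ on the interval $(c,d)$ with Lebesgue measure (variable of integration: the displayed variable; $1/\infty=0$). $SV$ is the set of positive Lebesgue measurable functions $b$ on $(0,\infty)$ that are slowly varying: for each $\varepsilon>0$, $t^{\varepsilon}b(t)$ is equivalent to an increasing function and $t^{-\varepsilon}b(t)$ is equivalent to a decreasing function, where two positive functions are equivalent if each is bounded by a constant multiple of the other. For $0\le\theta\le1$, $0<q\le\infty$, $b\in SV$, $\bar X_{\theta,q,b}=(X_0,X_1)_{\theta,q,b}$ is the space of $f\in X_0+X_1$ with $\|f\|=\left\|u^{-\theta-1/q}b(u)K(u,f)\right\|_{q,(0,\infty)}<\infty$. For $0<\sigma<1$, $0<r,q\le\infty$, $a,b\in SV$, $\bar X^{\mathcal R}_{\sigma,r,b,q,a}$ is the space of $f\in X_0+X_1$ with $\|f\|=\left\|t^{-1/r}\frac{b(t)}{a(t)}\left\|u^{-\sigma-1/q}a(u)K(u,f)\right\|_{q,(t,\infty)}\right\|_{r,(0,\infty)}<\infty$. $X\cong Y$ means that $X$ and $Y$ are continuously embedded in each other (same space, equivalent quasi-norms). *)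

(* Defs.v *)
(* MathComp / MathComp-Analysis *)
From HB Require Import structures.
From mathcomp Require Import all_boot all_order all_algebra.
From mathcomp Require Import all_classical all_reals all_analysis.

Set Implicit Arguments.
Unset Strict Implicit.
Unset Printing Implicit Defensive.

Import Order.TTheory GRing.Theory Num.Theory.
Import numFieldNormedType.Exports.

Local Open Scope classical_set_scope.
Local Open Scope ring_scope.

(* The line with the sigma-algebra of Lebesgue measurable sets (the Borel sets
   are the measurable sets of R itself). *)
Definition lebesgueR (R : realType) :=
  caratheodory_type ((@wlength R idfun)^*)%mu.

(* 1/q for 0 < q <= +oo, with 1/+oo = 0. *)
Definition rinv (R : realType) (q : \bar R) : R := fine (q^-1)%E.

(* (Quasi-)norm of g in L_q(I), 0 < q <= +oo, for Lebesgue measure; g is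
   extended by 0 outside I. *)
Definition lqnorm (R : realType) (q : \bar R) (I : interval R)
    (g : R -> \bar R) : \bar R :=
  @Lnorm _ (lebesgueR R) R (@completed_lebesgue_measure R) q (g \_ [set` I]).

(* Comparability of two functions on (0, oo). *)
Definition equiv_pos (R : realType) (f g : R -> R) : Prop :=
  exists2 C : R, 0 < C &
    forall t : R, 0 < t -> f t <= C * g t /\ g t <= C * f t.

Definition pos_fun (R : realType) (f : R -> R) : Prop :=
  forall t : R, 0 < t -> 0 < f t.

(* Only the restriction of b to (0, oo) matters. *)
Definition SV (R : realType) (b : R -> R) : Prop :=
  [/\ pos_fun b,
      @measurable_fun _ _ (lebesgueR R) R `]0, +oo[ b &
      forall e : R, 0 < e ->
        (exists phi : R -> R,
           [/\ pos_fun phi, {in `]0, +oo[ &, {homo phi : s t / s <= t}} &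
               equiv_pos (fun t => t `^ e * b t) phi])
        /\
        (exists psi : R -> R,
           [/\ pos_fun psi, {in `]0, +oo[ &, {homo psi : s t /~ s <= t}} &
               equiv_pos (fun t => t `^ (- e) * b t) psi])].

(* A space is presented inside an ambient real vector space V, as a set of
   vectors with a functional whose values outside that set are irrelevant.
   Complex spaces are covered by restriction of scalars, which changes none of
   the notions below. *)
Record qspace (R : realType) (V : lmodType R) := QSpace {
  carrier : set V ;
  qnorm : V -> R }.

Record quasi_banach (R : realType) (V : lmodType R) (X : qspace V) : Prop := {
  qb_zero : carrier X 0 ;
  qb_add : forall f g, carrier X f -> carrier X g -> carrier X (f + g) ;
  qb_scale : forall (k : R) f, carrier X f -> carrier X (k *: f) ;
  qb_ge0 : forall f, carrier X f -> 0 <= qnorm X f ;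
  qb_eq0 : forall f, carrier X f -> qnorm X f = 0 -> f = 0 ;
  qb_homog : forall (k : R) f, carrier X f ->
    qnorm X (k *: f) = `|k| * qnorm X f ;
  qb_triangle : exists2 C : R, 1 <= C &
    forall f g, carrier X f -> carrier X g ->
      qnorm X (f + g) <= C * (qnorm X f + qnorm X g) ;
  qb_complete : forall u : nat -> V, (forall n, carrier X (u n)) ->
    (forall e : R, 0 < e -> exists N : nat, forall m n : nat,
       (N <= m)%N -> (N <= n)%N -> qnorm X (u m - u n) < e) ->
    exists2 f, carrier X f & qnorm X (u n - f) @[n --> \oo] --> (0 : R) }.

(* Continuity at 0 of the (linear) inclusion of X into V. *)
Definition cont_included (R : realType) (V : topologicalLmodType R)
    (X : qspace V) : Prop :=
  forall U : set V, nbhs 0 U ->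
    exists2 e : R, 0 < e & forall f, carrier X f -> qnorm X f < e -> U f.

(* The ambient space is not assumed locally convex, since quasi-Banach spaces
   need not embed into locally convex ones. *)
Definition compatible_couple (R : realType) (V : topologicalLmodType R)
    (X0 X1 : qspace V) : Prop :=
  [/\ hausdorff_space V, quasi_banach X0, quasi_banach X1,
      cont_included X0 & cont_included X1].

Definition sum_space (R : realType) (V : lmodType R) (X0 X1 : qspace V) :
    set V :=
  [set f | exists f0 f1, [/\ carrier X0 f0, carrier X1 f1 & f = f0 + f1]].

(* Meaningful for f in X0 + X1 only. *)
Definition Kfun (R : realType) (V : lmodType R) (X0 X1 : qspace V)
    (t : R) (f : V) : R :=
  inf [set x | exists f0 f1, [/\ carrier X0 f0, carrier X1 f1, f = f0 + f1 &
                                 x = qnorm X0 f0 + t * qnorm X1 f1]].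

(* The space of f in X0 + X1 where the extended functional N is finite. *)
Definition finite_space (R : realType) (V : lmodType R) (X0 X1 : qspace V)
    (N : V -> \bar R) : qspace V :=
  {| carrier := [set f | sum_space X0 X1 f /\ (N f < +oo)%E] ;
     qnorm := fun f => fine (N f) |}.

Definition interp_space (R : realType) (V : lmodType R) (X0 X1 : qspace V)
    (theta : R) (q : \bar R) (b : R -> R) : qspace V :=
  finite_space X0 X1 (fun f =>
    lqnorm q `]0, +oo[ (fun u =>
      (u `^ (- theta - rinv q) * b u * Kfun X0 X1 u f)%:E)).

(* The inner norm may be +oo, hence the product in the extended reals. *)
Definition R_space (R : realType) (V : lmodType R) (X0 X1 : qspace V)
    (sigma : R) (r : \bar R) (b : R -> R) (q : \bar R) (a : R -> R) :
    qspace V :=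
  finite_space X0 X1 (fun f =>
    lqnorm r `]0, +oo[ (fun t =>
      ((t `^ (- rinv r) * (b t / a t))%:E *
       lqnorm q `]t, +oo[ (fun u =>
         (u `^ (- sigma - rinv q) * a u * Kfun X0 X1 u f)%:E))%E)).

Definition cont_embedded (R : realType) (V : lmodType R) (X Y : qspace V) :
    Prop :=
  carrier X `<=` carrier Y /\
  exists2 C : R, 0 < C &
    forall f, carrier X f -> qnorm Y f <= C * qnorm X f.

Definition same_space (R : realType) (V : lmodType R) (X Y : qspace V) :
    Prop :=
  cont_embedded X Y /\ cont_embedded Y X.

(* Main.v *)
(** The idea is a Holmstedt-type formula for the couple (X, A1), where X is the
    R-space.  Bounding the norm of X from below by the integrals over s < t < u
    gives

      t^-theta0 c0(t) K(t, f; A0, A1) <= C K(rho(t), f; X, A1).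

    Conversely let f = f0 + f1 be nearly K-optimal at t; since K(u, f0) is at
    most C K(min(u, t), f), K(rho(t), f; X, A1) <= C t^-theta0 c0(t) K(t, f) as
    soon as Y(u) = u^-eta asharp(u) K(u, f) satisfies Y(u) <= (t/u)^m Y(t) for
    u <= t.  In general Y(t) has to be replaced by the supremum of (u/t)^m Y(u)
    over u <= t, which has an equivalent L_r norm because of the geometric
    decay.  Since rho varies regularly with index 1 - theta0 > 0, the points
    rho(M^k), k integer, are spaced geometrically for M large, and both norms
    are equivalent to l_r norms over the integers of the values at rho(M^k)
    and at M^k: this replaces the change of variables v = rho(t).

    As rho need not be monotone and a is only Lebesgue measurable, a o rho and
    hence asharp need not be measurable.  The integral is then a lower integral,
    so all estimates rest on its monotonicity and on comparison with step
    functions. *)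

Require Import Defs.
From mathcomp Require Import all_boot all_order all_algebra.
From mathcomp Require Import all_classical all_reals all_analysis.
From mathcomp Require Import measurable_realfun ess_sup_inf simple_functions.
From mathcomp Require Import lra ring zify.

Set Implicit Arguments.
Unset Strict Implicit.
Unset Printing Implicit Defensive.

Import Order.TTheory GRing.Theory Num.Theory.
Import numFieldNormedType.Exports.

Local Open Scope classical_set_scope.
Local Open Scope ring_scope.

(** * Lower integrals *)

Section LowerIntegral.
Context d (T : measurableType d) (R : realType).
Variable mu : {measure set T -> \bar R}.
Local Open Scope ereal_scope.
Import HBNNSimple.

(** This is the definition of the integral of a nonnegative function, measurable or not. The section
    derives from it only rules that survive without measurability of [f]. *)
Lemma integral_nnsfun_sup (f : T -> \bar R) : (forall x, 0 <= f x) ->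
  \int[mu]_x f x = ereal_sup [set \int[mu]_x (h x)%:E |
    h in [set h : {nnsfun T >-> R} | forall x, (h x)%:E <= f x]].
Proof.
move=> f0; rewrite ge0_integralTE//; congr ereal_sup.
by apply/seteqP; split=> _ [h hf <-]; exists h => //; rewrite integralT_nnsfun.
Qed.

Lemma lower_integral_le (f : T -> \bar R) c : (forall x, 0 <= f x) ->
  (forall h : {nnsfun T >-> R}, (forall x, (h x)%:E <= f x) ->
     \int[mu]_x (h x)%:E <= c) -> \int[mu]_x f x <= c.
Proof.
move=> f0 H; rewrite integral_nnsfun_sup//; apply: ge_ereal_sup => _ [h hf <-].
exact: H.
Qed.

Lemma lower_integral_mono (f g : T -> \bar R) : (forall x, 0 <= f x) ->
  (forall x, f x <= g x) -> \int[mu]_x f x <= \int[mu]_x g x.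
Proof.
move=> f0 fg; have g0 x : 0 <= g x by exact: le_trans (f0 x) (fg x).
apply: lower_integral_le => // h hf; rewrite [leRHS]integral_nnsfun_sup//.
apply: ereal_sup_ubound; exists h => // x; exact: le_trans (hf x) (fg x).
Qed.

Lemma measurable_nnsfun_EFin (h : {nnsfun T >-> R}) :
  measurable_fun setT (EFin \o h).
Proof. by apply/measurable_EFinP. Qed.

(** A simple minorant of [k * f], divided by [k], is a simple minorant of [f]. *)
Lemma lower_integral_scale (f : T -> \bar R) (k : R) : (0 < k)%R ->
  (forall x, 0 <= f x) ->
  \int[mu]_x (k%:E * f x) <= k%:E * \int[mu]_x f x.
Proof.
move=> k0 f0; apply: lower_integral_le.
  by move=> x; rewrite mule_ge0// lee_fin ltW.
move=> h hf.
have k1 : (0 <= k^-1)%R by rewrite invr_ge0 ltW.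
suff : k^-1%:E * \int[mu]_x (h x)%:E <= \int[mu]_x f x.
  move=> H; rewrite -[leLHS]mul1e (_ : 1 = k%:E * k^-1%:E); last first.
    by rewrite -EFinM divff ?gt_eqF.
  by rewrite -muleA lee_pmul2l// ?lte_fin.
rewrite -ge0_integralZl_EFin//; last 2 first.
- by move=> x _; rewrite lee_fin.
- exact: measurable_nnsfun_EFin.
apply: lower_integral_mono => x.
  by rewrite mule_ge0// lee_fin.
rewrite muleC lee_pdivrMr// muleC; exact: hf.
Qed.

(** Lower integrals are not subadditive in general. Here the simple minorant [h], which is
    measurable, is cut along the measurable set [A], and each piece lies below [f1] or [f2]. *)
Lemma lower_integral_split (f f1 f2 : T -> \bar R) (A : set T) :
  measurable A -> (forall x, 0 <= f x) ->
  (forall x, A x -> f x <= f1 x) -> (forall x, ~ A x -> f x <= f2 x) ->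
  (forall x, 0 <= f1 x) -> (forall x, 0 <= f2 x) ->
  \int[mu]_x f x <= \int[mu]_x f1 x + \int[mu]_x f2 x.
Proof.
move=> mA f0 Af1 Af2 f10 f20; apply: lower_integral_le => // h hf.
rewrite -[leLHS]/(\int[mu]_(x in setT) _) -[in leLHS](setUv A).
rewrite ge0_integral_setU//=; last 4 first.
- exact: measurableC.
- by rewrite setUv; exact: measurable_nnsfun_EFin.
- by move=> x _; rewrite lee_fin.
- by apply/disj_setPS => x [].
rewrite (integral_mkcond A) (integral_mkcond (~` A)).
have hh x : 0 <= (h x)%:E by rewrite lee_fin.
apply: leeD; [apply: (@lower_integral_mono ((fun x => (h x)%:E) \_ A) f1)|
  apply: (@lower_integral_mono ((fun x => (h x)%:E) \_ (~` A)) f2)] => x;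
  rewrite /patch; case: ifPn => //.
- by rewrite inE => Ax; apply: le_trans (hf x) _; exact: Af1.
- by rewrite inE => Ax; apply: le_trans (hf x) _; exact: Af2.
Qed.

End LowerIntegral.

(** * The norm of L_q *)

Lemma le_poweR (R : realType) (r : R) (x y : \bar R) :
  0 <= r -> (0 <= x)%E -> (x <= y)%E -> (x `^ r <= y `^ r)%E.
Proof.
move=> r0 x0 xy; apply: gt0_ler_poweR => //; rewrite in_itv/= leey andbT//.
exact: le_trans xy.
Qed.

Section Lqnorm.
Context (R : realType).
Implicit Types (q : \bar R) (I : interval R) (g : R -> \bar R).

Local Notation mu := (@completed_lebesgue_measure R).

Lemma completed_lebesgue_measure_itv I :
  mu [set` I] = (if I.1 < I.2 then (I.2 : \bar R) - I.1 else 0)%E.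
Proof. exact: lebesgue_measure_itv. Qed.

Lemma measurable_itv_lebesgueR I : @measurable _ (lebesgueR R) [set` I].
Proof. by apply: sub_caratheodory; exact: measurable_itv. Qed.

Lemma completed_lebesgue_measure_setT_gt0 : (0 < mu setT)%E.
Proof.
by rewrite -set_itvNyy completed_lebesgue_measure_itv /= addey// ltry.
Qed.

Lemma lqnorm_finE (q : R) I g : lqnorm q%:E I g =
  ((\int[mu]_x (`|(g \_ [set` I]) x| `^ q)) `^ q^-1)%E.
Proof. by rewrite /lqnorm unlock. Qed.

Lemma lqnorm_yE I g :
  lqnorm +oo%E I g = ess_sup mu (abse \o (g \_ [set` I])).
Proof. by rewrite /lqnorm unlock completed_lebesgue_measure_setT_gt0. Qed.

Lemma lqnorm_ge0 q I g : (0 <= lqnorm q I g)%E.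
Proof. exact: Lnorm_ge0. Qed.

Lemma lqnorm_le q I1 I2 g1 g2 : (0 < q)%E ->
  {in I1, forall x, x \in I2 -> (0 <= g1 x <= g2 x)%E} ->
  {in I1, forall x, x \notin I2 -> g1 x = 0%E} ->
  (lqnorm q I1 g1 <= lqnorm q I2 g2)%E.
Proof.
move=> q0 g12 g10.
have H x : (`|(g1 \_ [set` I1]) x| <= `|(g2 \_ [set` I2]) x|)%E.
  rewrite /patch; case: ifPn => [|_]; last by rewrite abse0 abse_ge0.
  rewrite inE /= => xI; have [xI2|xI2] := boolP (x \in I2); last first.
    by rewrite g10// abse0 abse_ge0.
  rewrite mem_set//; have /andP[g0 gg] := g12 _ xI xI2.
  by rewrite !gee0_abs// (le_trans g0 gg).
case: q q0 => [q| |]// q0; last first.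
  by rewrite !lqnorm_yE; apply: le_ess_sup; apply/nearW => x /=; exact: H.
rewrite !lqnorm_finE; apply: le_poweR.
- by rewrite invr_ge0 ltW.
- by apply: integral_ge0 => x _; exact: poweR_ge0.
apply: lower_integral_mono => x; first exact: poweR_ge0.
by apply: le_poweR => //; rewrite ltW.
Qed.

Lemma lqnorm_mono q I1 I2 g1 g2 : (0 < q)%E -> {subset I1 <= I2} ->
  {in I1, forall x, (0 <= g1 x <= g2 x)%E} ->
  (lqnorm q I1 g1 <= lqnorm q I2 g2)%E.
Proof.
move=> q0 I12 g12; apply: lqnorm_le => // x xI1; first by move=> _; exact: g12.
by rewrite I12.
Qed.

Lemma eq_lqnorm q I g1 g2 : {in I, g1 =1 g2} -> lqnorm q I g1 = lqnorm q I g2.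
Proof.
move=> g12; congr Lnorm; apply/funext => x; rewrite /patch.
by case: ifPn => //; rewrite inE => /g12.
Qed.

Lemma lqnorm_scale_le q I g (k : R) : (0 < q)%E -> 0 < k ->
  {in I, forall x, (0 <= g x)%E} ->
  (lqnorm q I (fun x => k%:E * g x) <= k%:E * lqnorm q I g)%E.
Proof.
move=> q0 k0 g0.
have E x : (`|((fun x => k%:E * g x)%E \_ [set` I]) x| =
    k%:E * `|(g \_ [set` I]) x|)%E.
  rewrite /patch; case: ifPn => _; last by rewrite abse0 mule0.
  by rewrite abseM gee0_abs// lee_fin ltW.
case: q q0 => [q| |]// q0; last first.
  rewrite !lqnorm_yE -ess_sup_pZl//; apply: le_ess_sup.
  by apply/nearW => x; rewrite /= E.
rewrite !lqnorm_finE.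
rewrite -[X in (X * _)%E](_ : (k `^ q)%:E `^ q^-1 = k%:E)%E; last first.
  by rewrite poweR_EFin -powRrM divff ?gt_eqF// powRr1// ltW.
rewrite -poweRM; last 2 first.
- by rewrite lee_fin powR_ge0.
- by apply: integral_ge0 => x _; exact: poweR_ge0.
apply: le_poweR; first by rewrite invr_ge0 ltW.
  by apply: integral_ge0 => x _; exact: poweR_ge0.
apply: le_trans (lower_integral_scale _ _ _); last 2 first.
- by rewrite powR_gt0.
- by move=> x; exact: poweR_ge0.
apply: lower_integral_mono => x; first exact: poweR_ge0.
have E2 : (`|((fun x => k%:E * g x)%E \_ [set` I]) x| `^ q <=
    (k `^ q)%:E * `|(g \_ [set` I]) x| `^ q)%E.
  by rewrite E poweRM ?poweR_EFin// lee_fin ltW.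
exact: E2.
Qed.

(** The reverse inequality is [lqnorm_scale_le] for the factor [k^-1]. *)
Lemma lqnorm_scale q I g (k : R) : (0 < q)%E -> 0 < k ->
  {in I, forall x, (0 <= g x)%E} ->
  (lqnorm q I (fun x => k%:E * g x) = k%:E * lqnorm q I g)%E.
Proof.
move=> q0 k0 g0; apply/eqP; rewrite eq_le lqnorm_scale_le//=.
have kV : 0 < k^-1 by rewrite invr_gt0.
rewrite -lee_pdivlMl//.
rewrite [leLHS](_ : _ = lqnorm q I (fun x => k^-1%:E * (k%:E * g x)))%E.
  by apply: lqnorm_scale_le => // x xI; rewrite mule_ge0 ?g0// lee_fin ltW.
apply: eq_lqnorm => x xI.
by rewrite muleA -EFinM mulVf ?gt_eqF// mul1e.
Qed.

(** With [y] the larger of the two, [x + y <= 2 * y]; this treats [q < 1] and [q >= 1] alike. *)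
Lemma poweR_inv_subadd (q : R) (x y : \bar R) : 0 < q ->
  (0 <= x)%E -> (0 <= y)%E ->
  ((x + y) `^ q^-1 <= (2 `^ q^-1)%:E * (x `^ q^-1 + y `^ q^-1))%E.
Proof.
move=> q0 x0 y0.
have q1 : 0 <= q^-1 by rewrite invr_ge0 ltW.
wlog xy : x y x0 y0 / (x <= y)%E.
  move=> H; have /orP[xy|yx] := le_total x y; first exact: H.
  by rewrite addeC (addeC (_ `^ _)%E); exact: H.
apply: (@le_trans _ _ ((2%:E * y) `^ q^-1)%E).
  apply: le_poweR => //; first exact: adde_ge0.
  by rewrite (_ : 2%:E = 1%:E + 1%:E)%E// ge0_muleDl// mul1e leeD2r.
rewrite poweRM ?lee_fin// poweR_EFin lee_pmul2l ?lte_fin ?powR_gt0//.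
by rewrite leeDr// poweR_ge0.
Qed.

(** Replaces the quasi-triangle inequality, which may fail for nonmeasurable functions: the cut is
    made along an interval. *)
Lemma lqnorm_split q : (0 < q)%E -> exists2 C : R, 1 <= C &
  forall I I1 I2 g, (forall x, x \in I -> (x \in I1) || (x \in I2)) ->
    {in I, forall x, (0 <= g x)%E} ->
    (lqnorm q I g <= C%:E * (lqnorm q I1 g + lqnorm q I2 g))%E.
Proof.
case: q => [q| |]// q0; last first.
  exists 1 => // I I1 I2 g II g0; rewrite mul1e !lqnorm_yE.
  apply/ess_supP.
  have h1 := ess_sup_ge mu (abse \o (g \_ [set` I1])).
  have h2 := ess_sup_ge mu (abse \o (g \_ [set` I2])).
  have p1 : (0 <= ess_sup mu (abse \o (g \_ [set` I1])))%E.
    by rewrite -lqnorm_yE lqnorm_ge0.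
  have p2 : (0 <= ess_sup mu (abse \o (g \_ [set` I2])))%E.
    by rewrite -lqnorm_yE lqnorm_ge0.
  near=> x.
  have k1 : ((abse \o (g \_ [set` I1])) x <= ess_sup mu (abse \o (g \_ [set` I1])))%E.
    by near: x; exact: h1.
  have k2 : ((abse \o (g \_ [set` I2])) x <= ess_sup mu (abse \o (g \_ [set` I2])))%E.
    by near: x; exact: h2.
  rewrite /= {1}/patch; case: ifPn => [|_]; last first.
    by rewrite abse0 adde_ge0.
  rewrite inE /= => /II/orP[xI|xI].
    move: k1; rewrite /= /patch mem_set// => m1.
    by rewrite (le_trans m1)// leeDl.
  move: k2; rewrite /= /patch mem_set// => m2.
  by rewrite (le_trans m2)// leeDr.
exists (2 `^ q^-1).
  by rewrite -[leLHS](powRr0 2) ler_powR ?ler1n// invr_ge0 ltW.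
move=> I I1 I2 g II g0; rewrite !lqnorm_finE.
apply: le_trans (poweR_inv_subadd _ _ _) => //; last 2 first.
- by apply: integral_ge0 => x _; exact: poweR_ge0.
- by apply: integral_ge0 => x _; exact: poweR_ge0.
apply: le_poweR; first by rewrite invr_ge0 ltW.
  by apply: integral_ge0 => x _; exact: poweR_ge0.
have := (@lower_integral_split _ (lebesgueR R) R mu
  (fun x => `|(g \_ [set` I]) x| `^ q)%E (fun x => `|(g \_ [set` I1]) x| `^ q)%E
  (fun x => `|(g \_ [set` I2]) x| `^ q)%E [set` I1]).
apply.
- exact: measurable_itv_lebesgueR.
- by move=> x; exact: poweR_ge0.
- move=> x xI1; apply: le_poweR => //; first exact: ltW.
  rewrite /patch (mem_set xI1); case: ifPn => // _.
  by rewrite abse0.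
- move=> x xI1; apply: le_poweR => //; first exact: ltW.
  rewrite /patch; case: ifPn => [|_]; last by rewrite abse0 abse_ge0.
  rewrite inE/= => xI; have := II _ xI => /orP[//|xI2].
  by rewrite mem_set.
- by move=> x; exact: poweR_ge0.
- by move=> x; exact: poweR_ge0.
Unshelve. all: by end_near. Qed.

End Lqnorm.

(** * Geometric partitions of the half-line *)

Section StepFunction.
Context d (T : measurableType d) (R : realType).
Variable mu : {measure set T -> \bar R}.
Variables (A : nat -> set T) (c : nat -> R).
Hypotheses (mA : forall n, measurable (A n)) (tA : trivIset setT A)
  (c0 : forall n, 0 <= c n).
Local Open Scope ereal_scope.

Let step x : \bar R := \sum_(n <oo) (c n)%:E * (\1_(A n) x)%:E.

Let step_ge0 n x : 0 <= (c n)%:E * (\1_(A n) x)%:E.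
Proof. by rewrite mule_ge0 ?lee_fin. Qed.

Lemma stepE n x : A n x -> step x = (c n)%:E.
Proof.
move=> Ax; rewrite /step (nneseriesD1 (n := n))//=.
rewrite indicE mem_set// mule1 eseries0 ?adde0// => k _ /= kn.
rewrite indicE memNset ?mule0// => Akx.
by move/eqP: kn; apply; apply: tA => //; exists x.
Qed.

Lemma step0 x : (forall n, ~ A n x) -> step x = 0.
Proof.
move=> Ax; rewrite /step eseries0// => k _ /= kn.
by rewrite indicE memNset ?mule0.
Qed.

Lemma integral_step : \int[mu]_x step x = \sum_(n <oo) (c n)%:E * mu (A n).
Proof.
rewrite integral_nneseries//=.
  apply: eq_eseriesr => n _; rewrite ge0_integralZl_EFin//.
  - by rewrite integral_indic// setIT.
  - exact/measurable_EFinP.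
move=> n; apply: emeasurable_funM => //.
exact/measurable_EFinP.
Qed.

(** The step function is measurable and integrates term by term; [f] enters only through pointwise
    comparison with it. *)
Lemma lower_integral_le_step (f : T -> \bar R) : (forall x, 0 <= f x) ->
  (forall n x, A n x -> f x <= (c n)%:E) ->
  (forall x, (forall n, ~ A n x) -> f x = 0) ->
  \int[mu]_x f x <= \sum_(n <oo) (c n)%:E * mu (A n).
Proof.
move=> f0 fA fN; rewrite -integral_step; apply: lower_integral_mono => // x.
have [[n Ax]|H] := pselect (exists n, A n x).
  by rewrite (stepE Ax) fA.
by rewrite step0 ?fN// => n Ax; apply: H; exists n.
Qed.

Lemma step_le_lower_integral (f : T -> \bar R) : (forall x, 0 <= f x) ->
  (forall n x, A n x -> (c n)%:E <= f x) ->
  \sum_(n <oo) (c n)%:E * mu (A n) <= \int[mu]_x f x.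
Proof.
move=> f0 fA; rewrite -integral_step; apply: lower_integral_mono => // x.
  by apply: nneseries_ge0.
have [[n Ax]|H] := pselect (exists n, A n x).
  by rewrite (stepE Ax) fA.
by rewrite step0// => n Ax; apply: H; exists n.
Qed.

End StepFunction.

(** Enumerates the integers as 0, -1, 1, -2, 2, ..., which turns sums over them into series. The
    integer of rank [n] has absolute value at least [n / 2]. *)
Definition int_of_rank (n : nat) : int := if odd n then Negz n./2 else Posz n./2.

Lemma int_of_rank_bij : set_bij [set: nat] [set: int] int_of_rank.
Proof.
split=> //.
- move=> m n _ _; rewrite /int_of_rank.
  by case: ifPn => om; case: ifPn => on // -[mn]; lia.
- move=> [n|n] _.
    exists n.*2 => //; rewrite /int_of_rank odd_double; congr Posz.
    exact: doubleK.
  exists n.*2.+1 => //; rewrite /int_of_rank /= odd_double/=; congr Negz; lia.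
Qed.

Lemma esum_int (R : realType) (a : int -> \bar R) : (forall k, (0 <= a k)%E) ->
  \esum_(k in [set: int]) a k = (\sum_(n <oo) a (int_of_rank n))%E.
Proof.
move=> a0; rewrite (@reindex_esum _ _ _ _ _ _ a int_of_rank_bij) nneseries_esumT//.
Qed.

Lemma esum_int_shift (R : realType) (a : int -> \bar R) (n : int) :
  \esum_(k in [set: int]) a (k - n) = \esum_(k in [set: int]) a k.
Proof.
rewrite (@reindex_esum _ _ _ [set: int] [set: int] (fun k => k - n) a)//.
split=> //; first by move=> i j _ _ /addIr.
by move=> k _; exists (k + n) => //; rewrite addrK.
Qed.

(** The points cut the half-line into cells []v k, v (k + 1)]]. Consecutive ratios between 2 and [D]
    make the length of a cell comparable with both of its end points. *)
Definition cells (R : realType) (D : R) (v : int -> R) : Prop :=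
  forall k, [/\ 0 < v k, 2 * v k <= v (k + 1) & v (k + 1) <= D * v k].

Section Cells.
Context (R : realType) (D : R) (v : int -> R).
Hypothesis vD : cells D v.

Lemma cells_gt0 k : 0 < v k. Proof. by have [] := vD k. Qed.

Lemma cells_pow k n : 2 ^+ n * v k <= v (k + n%:Z).
Proof.
elim: n => [|n IH]; first by rewrite mul1r addr0.
have [_ + _] := vD (k + n%:Z).
rewrite -addrA (_ : n%:Z + 1 = n.+1%:Z); last lia.
by apply: le_trans; rewrite exprS -mulrA ler_pM2l.
Qed.

Lemma cells_lt k l : k < l -> v k < v l.
Proof.
move=> kl; have -> : l = k + `|l - k|%N%:Z by lia.
apply: lt_le_trans (cells_pow _ _).
rewrite ltr_pMl ?cells_gt0// exprn_egt1 ?ltr1n//; lia.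
Qed.

Lemma cells_le k l : k <= l -> v k <= v l.
Proof. by rewrite le_eqVlt => /predU1P[->//|/cells_lt/ltW]. Qed.

Lemma cells_cover x : 0 < x -> exists k, v k < x <= v (k + 1).
Proof.
move=> x0.
(* The growth [2 ^ n] beats the Archimedean bound [n]: this gives a point below [x], then one above
   it. *)
have [m Hm] : exists m, v (- m%:Z) < x.
  pose m := Num.bound (v 0 / x); exists m.
  have := cells_pow (- m%:Z) m; rewrite addNr => H.
  have : v 0 / x < m%:R by apply: archi_boundP; rewrite divr_ge0 ?ltW ?cells_gt0.
  rewrite ltr_pdivrMr// => H2.
  have H3 : m%:R <= 2 ^+ m :> R by rewrite -natrX ler_nat ltnW// ltn_expl.
  have : 2 ^+ m * v (- m%:Z) < 2 ^+ m * x.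
    by apply: (le_lt_trans H); apply: (lt_le_trans H2); rewrite ler_pM2r.
  by rewrite ltr_pM2l// exprn_gt0.
have [j Hj] : exists j, x <= v (- m%:Z + j%:Z).
  pose w := v (- m%:Z).
  pose j := Num.bound (x / w); exists j.
  apply: le_trans (cells_pow _ _).
  have : x / w < j%:R by apply: archi_boundP; rewrite divr_ge0 ?ltW ?cells_gt0.
  rewrite ltr_pdivrMr ?cells_gt0// => /ltW/le_trans; apply.
  rewrite ler_pM2r ?cells_gt0//.
  by rewrite -natrX ler_nat ltnW// ltn_expl.
have ex : exists j : nat, x <= v (- m%:Z + j%:Z) by exists j.
(* The least such index is positive because [v (- m) < x], and its predecessor is the index of the
   cell. *)
case: (ex_minnP ex) => -[|i] Hi Hmin.
  by move: Hi; rewrite addr0 leNgt Hm.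
exists (- m%:Z + i%:Z); apply/andP; split.
  by rewrite ltNge; apply/negP => /Hmin; rewrite ltnn.
by rewrite -addrA (_ : i%:Z + 1 = i.+1%:Z)//; lia.
Qed.

Lemma cells_uniq k l x : v k < x <= v (k + 1) -> v l < x <= v (l + 1) -> k = l.
Proof.
move=> /andP[k1 k2] /andP[l1 l2].
have := lt_le_trans k1 l2; have := lt_le_trans l1 k2 => H1 H2.
have [kl|kl|//] := ltgtP k l.
  have : v (k + 1) <= v l by apply: cells_le; lia.
  by rewrite leNgt H1.
have : v (l + 1) <= v k by apply: cells_le; lia.
by rewrite leNgt H2.
Qed.

Let cell n : set (lebesgueR R) :=
  [set` `]v (int_of_rank n), v (int_of_rank n + 1)] ].

Lemma trivIset_cell : trivIset setT cell.
Proof.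
move=> m n _ _ [x []]; rewrite /cell /= !in_itv/= => h1 h2.
have := cells_uniq h1 h2.
by have [_ + _] := int_of_rank_bij; apply; rewrite inE.
Qed.

Lemma measurable_cell n : measurable (cell n).
Proof. exact: measurable_itv_lebesgueR. Qed.

Lemma measure_cell n : @completed_lebesgue_measure R (cell n) =
  (v (int_of_rank n + 1) - v (int_of_rank n))%:E.
Proof.
rewrite /cell completed_lebesgue_measure_itv /= lte_fin cells_lt//; lia.
Qed.

Local Notation mu := (@completed_lebesgue_measure R).
Local Open Scope ereal_scope.

Lemma lower_integral_le_cells (f : lebesgueR R -> \bar R) (c : int -> R) :
  (forall x, 0 <= f x) -> (forall k, 0 <= c k)%R ->
  (forall k (x : R), (v k < x <= v (k + 1))%R -> f x <= (c k)%:E) ->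
  (forall x : R, (x <= 0)%R -> f x = 0) ->
  \int[mu]_x f x <= \esum_(k in [set: int]) (c k * (v (k + 1) - v k))%:E.
Proof.
move=> f0 c0 fc fN; rewrite esum_int; last first.
  move=> k; rewrite lee_fin mulr_ge0// subr_ge0 cells_le//; lia.
apply: le_trans (lower_integral_le_step mu measurable_cell trivIset_cell
  (c := c \o int_of_rank) _ _ _ _) _ => //=.
- by move=> n x; rewrite /cell /= in_itv/= => /fc.
- move=> x Nx; apply: fN; rewrite leNgt; apply/negP => /cells_cover[k kx].
  have [_ _ /(_ k I) [n _ nk]] := int_of_rank_bij.
  by apply: (Nx n); rewrite /cell /= in_itv/= nk.
apply: lee_nneseries => [n _ _|n _]; first by rewrite mule_ge0 ?lee_fin.
by rewrite measure_cell -EFinM.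
Qed.

Lemma cells_le_lower_integral (f : lebesgueR R -> \bar R) (c : int -> R) :
  (forall x, 0 <= f x) -> (forall k, 0 <= c k)%R ->
  (forall k (x : R), (v k < x <= v (k + 1))%R -> (c k)%:E <= f x) ->
  \esum_(k in [set: int]) (c k * (v (k + 1) - v k))%:E <= \int[mu]_x f x.
Proof.
move=> f0 c0 fc; rewrite esum_int; last first.
  move=> k; rewrite lee_fin mulr_ge0// subr_ge0 cells_le//; lia.
apply: le_trans (step_le_lower_integral mu measurable_cell trivIset_cell
  (c := c \o int_of_rank) _ _ _) => //=.
  apply: lee_nneseries => [n _ _|n _]; last by rewrite measure_cell -EFinM.
  by rewrite lee_fin mulr_ge0// subr_ge0 cells_le//; lia.
by move=> n x; rewrite /cell /= in_itv/= => /fc.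
Qed.

End Cells.

(** * Discretization *)

Lemma rinv_fin (R : realType) (q : R) : rinv q%:E = q^-1.
Proof. exact: fine_invr. Qed.

Lemma rinv_y (R : realType) : rinv (+oo : \bar R)%E = 0.
Proof. by rewrite /rinv invey. Qed.

(** The l_r quasi-norm of a nonnegative two-sided sequence; the second branch is meant for
    [r = +oo]. *)
Definition ell (R : realType) (r : \bar R) (y : int -> R) : \bar R :=
  if r is r%:E then
    ((\esum_(k in [set: int]) (y k `^ r)%:E) `^ r^-1)%E
  else ereal_sup (range (fun k => (y k)%:E)).

Lemma nneseries_le (R : realType) (u : nat -> R) (c : R) :
  (forall n, 0 <= u n) -> (forall n, \sum_(0 <= i < n) u i <= c) ->
  (\sum_(n <oo) (u n)%:E <= c%:E)%E.
Proof.
move=> u0 uc; apply: lime_le.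
  by apply: is_cvg_nneseries => n _ _; rewrite lee_fin.
by apply: nearW => n; rewrite sumEFin lee_fin.
Qed.

Lemma geometric_nneseries_le (R : realType) (A q : R) : 0 <= A -> 0 < q < 1 ->
  (\sum_(n <oo) (A * q ^+ n)%:E <= (A / (1 - q))%:E)%E.
Proof.
move=> A0 /andP[q0 q1]; apply: nneseries_le => n.
  by rewrite mulr_ge0// exprn_ge0// ltW.
have := @geometric_le_lim R n A q A0 q0.
by rewrite gtr0_norm// => /(_ q1).
Qed.

Lemma nneseries_ge_term (R : realType) (u : nat -> \bar R) n :
  (forall i, (0 <= u i)%E) -> (u n <= \sum_(i <oo) u i)%E.
Proof.
move=> u0; rewrite (nneseriesD1 (n := n))// leeDl//.
by apply: nneseries_ge0.
Qed.

Section Discretization.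
Context (R : realType).
Implicit Types (r : \bar R) (F : R -> R) (x y : int -> R).

(** The weight turns the r-th power of the norm into an integral for du/u. On a cell
    [1 / u <= 1 / v k], and the length is at most [D * v k], so each cell contributes at most
    [D * y k ^ r]. *)
Lemma lqnorm_le_ell r (D : R) (v : int -> R) F y : (0 < r)%E -> cells D v ->
  (forall k u, v k < u <= v (k + 1) -> 0 <= F u <= y k) ->
  (lqnorm r `]0%R, +oo[ (fun u => (u `^ (- rinv r) * F u)%:E) <=
   (D `^ rinv r)%:E * ell r y)%E.
Proof.
move=> r0 vD Fy.
have D0 : 0 < D.
  have [v0 h1 h2] := vD 0; rewrite -(pmulr_lgt0 _ v0).
  by apply: lt_le_trans h2; apply: lt_le_trans h1; rewrite mulr_gt0.
have y0 k : 0 <= y k.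
  have kk : v k < v (k + 1) <= v (k + 1) by rewrite lexx (cells_lt vD)//; lia.
  by have /andP[F0] := Fy k _ kk; exact: le_trans.
case: r r0 => [r| |]// r0; last first.
  rewrite lqnorm_yE rinv_y powRr0 mul1e; apply/ess_supP/nearW => u /=.
  rewrite /patch; case: ifPn => [|_]; last first.
    rewrite abse0; apply: ereal_sup_ge; exists (y 0)%:E; first by exists 0.
    by rewrite lee_fin.
  rewrite inE/= in_itv/= andbT => u0.
  have [k ku] := cells_cover vD u0; have /andP[F0 Fk] := Fy _ _ ku.
  rewrite oppr0 powRr0 mul1r ger0_norm//.
  by apply: ereal_sup_ge; exists (y k)%:E; [exists k|rewrite lee_fin].
rewrite lqnorm_finE rinv_fin /ell.
have r1 : 0 <= r^-1 by rewrite invr_ge0 ltW.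
rewrite -poweR_EFin -poweRM; last 2 first.
- by rewrite lee_fin ltW.
- by apply: esum_ge0 => k _; rewrite lee_fin powR_ge0.
apply: le_poweR => //; first by apply: integral_ge0 => u _; exact: poweR_ge0.
apply: le_trans (lower_integral_le_cells vD (c := fun k => y k `^ r / v k) _ _ _ _) _.
- by move=> u; exact: poweR_ge0.
- by move=> k; rewrite divr_ge0 ?powR_ge0// ltW// (cells_gt0 vD).
- move=> k u ku; have vk := cells_gt0 vD k; have /andP[ku1 ku2] := ku.
  have u0 : 0 < u by exact: lt_trans vk ku1.
  have /andP[F0 Fk] := Fy _ _ ku.
  rewrite /patch mem_set /=; last by rewrite in_itv/= andbT.
  rewrite ger0_norm ?mulr_ge0 ?powR_ge0//.
  rewrite lee_fin powRM ?powR_ge0// -powRrM mulNr mulVf ?gt_eqF//.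
  rewrite powR_inv1 ?(ltW u0)// mulrC; apply: ler_pM.
  + by rewrite powR_ge0.
  + by rewrite invr_ge0 ltW.
  + by apply: ge0_ler_powR; rewrite ?nnegrE// ltW.
  + by rewrite lef_pV2 ?posrE// ltW.
- move=> u u0; rewrite /patch memNset ?abse0 ?poweR0r ?gt_eqF//=.
  by rewrite in_itv/= andbT => /(le_lt_trans u0); rewrite ltxx.
rewrite !esum_int; last 2 first.
- by move=> k; rewrite lee_fin powR_ge0.
- move=> k; rewrite lee_fin mulr_ge0 ?divr_ge0 ?powR_ge0//.
    by rewrite ltW// (cells_gt0 vD).
  by rewrite subr_ge0 (cells_le vD)//; lia.
rewrite -nneseriesZl; last by move=> n _; rewrite lee_fin powR_ge0.
apply: lee_nneseries => [n _ _|n _].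
  rewrite lee_fin mulr_ge0 ?divr_ge0 ?powR_ge0//.
    by rewrite ltW// (cells_gt0 vD).
  by rewrite subr_ge0 (cells_le vD)//; lia.
set k := int_of_rank n; rewrite -EFinM lee_fin -mulrA mulrC.
apply: ler_wpM2r; first by rewrite powR_ge0.
have [vk _ vDk] := vD k.
rewrite mulrC ler_pdivrMr//; lra.
Qed.

(** On a cell [1 / u >= 1 / v (k + 1)], and the length is at least [v (k + 1) / 2], so each cell
    contributes at least [y k ^ r / 2]. *)
Lemma ell_le_lqnorm r (D : R) (v : int -> R) F y : (0 < r)%E -> cells D v ->
  (forall k, 0 <= y k) ->
  (forall k u, v k < u <= v (k + 1) -> y k <= F u) ->
  (ell r y <= (2 `^ rinv r)%:E *
    lqnorm r `]0%R, +oo[ (fun u => (u `^ (- rinv r) * F u)%:E))%E.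
Proof.
move=> r0 vD y0 yF.
case: r r0 => [r| |]// r0; last first.
  rewrite lqnorm_yE rinv_y powRr0 mul1e /ell; apply: ge_ereal_sup => _ [k _ <-].
  set g := (abse \o _).
  have [N [mN N0 Ng]] := ess_sup_ge (@completed_lebesgue_measure R) g.
  set E := ess_sup _ _ in Ng *.
  (* A cell has positive measure, so the null set [N] off which [g <= E] cannot contain it. *)
  have [u [ku Nu]] : exists u, v k < u <= v (k + 1) /\ ~ N u.
    apply: contrapT => H.
    pose I := `]v k, v (k + 1)].
    have : (@completed_lebesgue_measure R [set` I] <= @completed_lebesgue_measure R N)%E.
      apply: le_measure; rewrite ?inE//; first exact: measurable_itv_lebesgueR.
      move=> u /=; rewrite in_itv/= => ku.
      by apply: contrapT => Nu; apply: H; exists u.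
    rewrite N0 completed_lebesgue_measure_itv/= lte_fin (cells_lt vD) ?ltrDl//.
    by rewrite -EFinB lee_fin subr_le0 leNgt (cells_lt vD)// ltrDl.
  have gE : (g u <= E)%E by apply: contrapT => /Ng.
  apply: le_trans gE; rewrite /g /= /patch mem_set /=; last first.
    rewrite in_itv/= andbT; have /andP[+ _] := ku; apply: lt_trans.
    exact: cells_gt0 vD k.
  rewrite oppr0 powRr0 mul1r lee_fin; apply: le_trans (ler_norm _).
  exact: yF.
rewrite lqnorm_finE rinv_fin /ell.
have r1 : 0 <= r^-1 by rewrite invr_ge0 ltW.
rewrite -poweR_EFin -poweRM//; last first.
  by apply: integral_ge0 => u _; exact: poweR_ge0.
apply: le_poweR => //.
  by apply: esum_ge0 => k _; rewrite lee_fin powR_ge0.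
rewrite -lee_pdivrMl//.
apply: le_trans (cells_le_lower_integral vD
  (c := fun k => y k `^ r / v (k + 1)) _ _ _); first last.
- move=> k u ku; have vk := cells_gt0 vD k; have /andP[ku1 ku2] := ku.
  have u0 : 0 < u by exact: lt_trans vk ku1.
  have Fk := yF _ _ ku.
  have F0 : 0 <= F u by exact: le_trans Fk.
  rewrite /patch mem_set /=; last by rewrite in_itv/= andbT.
  rewrite ger0_norm ?mulr_ge0 ?powR_ge0//.
  rewrite lee_fin powRM ?powR_ge0// -powRrM mulNr mulVf ?gt_eqF//.
  rewrite powR_inv1 ?(ltW u0)// mulrC; apply: ler_pM.
  + by rewrite invr_ge0 ltW// (cells_gt0 vD).
  + by rewrite powR_ge0.
  + by rewrite lef_pV2 ?posrE// (cells_gt0 vD).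
  + by apply: ge0_ler_powR; rewrite ?nnegrE// ltW.
- by move=> k; rewrite divr_ge0 ?powR_ge0// ltW// (cells_gt0 vD).
- by move=> u; exact: poweR_ge0.
rewrite !esum_int; last 2 first.
- move=> k; rewrite lee_fin mulr_ge0 ?divr_ge0 ?powR_ge0//.
    by rewrite ltW// (cells_gt0 vD).
  by rewrite subr_ge0 (cells_le vD)//; lia.
- by move=> k; rewrite lee_fin powR_ge0.
rewrite -nneseriesZl; last by move=> n _; rewrite lee_fin powR_ge0.
apply: lee_nneseries => [n _ _|n _].
  by rewrite -EFinM lee_fin mulr_ge0 ?powR_ge0.
set k := int_of_rank n; rewrite -EFinM lee_fin -mulrA mulrC.
apply: ler_wpM2l; first by rewrite powR_ge0.
have [_ v2k vDk] := vD k; have vk := cells_gt0 vD (k + 1).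
rewrite mulrC ler_pdivlMr//; lra.
Qed.

(* A discrete Hardy inequality: the hypothesis says that x k is at most C times
   the supremum over n of d ^+ n * y (k - n), and the supremum is dominated by
   the l_r sum, whose terms are translates of y. *)
Lemma ell_shift_sup r (d C : R) : (0 < r)%E -> 0 < d < 1 -> 0 < C ->
  exists2 C' : R, 0 < C' & forall x y, (forall k, 0 <= x k) ->
    (forall k, 0 <= y k) ->
    (forall k s, (forall n : nat, d ^+ n * y (k - n%:Z) <= s) -> x k <= C * s) ->
    (ell r x <= C'%:E * ell r y)%E.
Proof.
move=> r0 /andP[d0 d1] C0.
case: r r0 => [r| |]// r0; last first.
  exists C => // x y x0 y0 H; rewrite /ell.
  case E : (ereal_sup (range (fun k => (y k)%:E))) => [e| |].
  - apply: ge_ereal_sup => _ [k _ <-]; rewrite -EFinM lee_fin; apply: H => n.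
    have : ((y (k - n%:Z))%:E <= e%:E)%E.
      by rewrite -E; apply: ereal_sup_ubound; exists (k - n%:Z).
    rewrite lee_fin; apply: le_trans; rewrite ler_piMl// exprn_ile1//; exact: ltW.
  - by rewrite gt0_muley ?lte_fin// leey.
  - have : ((y 0)%:E <= -oo :> \bar R)%E.
      by rewrite -E; apply: ereal_sup_ubound; exists 0.
    by [].
have r1 : 0 <= r^-1 by rewrite invr_ge0 ltW.
have dr : 0 < d `^ r < 1.
  rewrite powR_gt0//=.
  have := gt0_ltr_powR r0 (ltW d0 : d \in Num.nneg) (ler01 : 1 \in Num.nneg) d1.
  by rewrite powR1.
(* The denominator sums the geometric series of ratio [d ^ r] produced by the translates of [y]. *)
pose K := C `^ r / (1 - d `^ r).
have K0 : 0 < K by rewrite divr_gt0 ?powR_gt0// subr_gt0; case/andP: dr.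
exists (K `^ r^-1); first exact: powR_gt0.
move=> x y x0 y0 H; rewrite /ell.
set X := (X in (X `^ _)%E); set Y := (X in (_ <= _ * (X `^ _))%E).
have Y0 : (0 <= Y)%E by apply: esum_ge0 => k _; rewrite lee_fin powR_ge0.
rewrite -poweR_EFin -poweRM ?lee_fin ?(ltW K0)//.
apply: le_poweR => //.
  by apply: esum_ge0 => k _; rewrite lee_fin powR_ge0.
(* When finite, [a k] to the power [1 / r] is an admissible [s] in the hypothesis. *)
pose a k : \bar R := (\sum_(n <oo) ((d ^+ n * y (k - n%:Z)) `^ r)%:E)%E.
have a0 k : (0 <= a k)%E by apply: nneseries_ge0 => n _ _; rewrite lee_fin powR_ge0.
have xa k : ((x k `^ r)%:E <= (C `^ r)%:E * a k)%E.
  case Ea : (a k) => [A| |]; last 2 first.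
  - by rewrite gt0_muley ?lte_fin ?powR_gt0// leey.
  - by have := a0 k; rewrite Ea.
  have A0 : 0 <= A by rewrite -lee_fin -Ea.
  have : x k <= C * (A `^ r^-1).
    apply: H => n.
    have : (((d ^+ n * y (k - n%:Z)) `^ r)%:E <= A%:E)%E.
      rewrite -Ea; apply: (nneseries_ge_term
        (u := fun n => ((d ^+ n * y (k - n%:Z)) `^ r)%:E)) => i.
      by rewrite lee_fin powR_ge0.
    rewrite lee_fin => /(ge0_ler_powR r1).
    rewrite !nnegrE powR_ge0 => /(_ isT A0).
    rewrite -powRrM divff ?gt_eqF// powRr1// mulr_ge0// exprn_ge0//; exact: ltW.
  move=> /(ge0_ler_powR (ltW r0)); rewrite !nnegrE => /(_ (x0 k)).
  rewrite mulr_ge0 ?powR_ge0 ?(ltW C0)// => /(_ isT).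
  by rewrite powRM ?powR_ge0 ?(ltW C0)// -powRrM mulVf ?gt_eqF// powRr1.
apply: (@le_trans _ _ ((C `^ r)%:E * \sum_(n <oo) a (int_of_rank n))%E).
  rewrite /X esum_int; last by move=> k; rewrite lee_fin powR_ge0.
  rewrite -nneseriesZl//; apply: lee_nneseries => [n _ _|n _]; last exact: xa.
  by rewrite lee_fin powR_ge0.
rewrite /K mulrC EFinM [X in (_ <= X * _)%E]muleC -muleA.
apply: lee_wpmul2l; first by rewrite lee_fin powR_ge0.
rewrite /a nneseries_interchange; last by move=> i j; rewrite lee_fin powR_ge0.
have E n : (\sum_(m <oo) ((d ^+ n * y (int_of_rank m - n%:Z)) `^ r)%:E =
    ((d `^ r) ^+ n)%:E * Y)%E.
  rewrite /Y -(esum_int_shift _ n%:Z) esum_int; last first.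
    by move=> k; rewrite lee_fin powR_ge0.
  rewrite -nneseriesZl; last by move=> m _; rewrite lee_fin powR_ge0.
  apply: eq_eseriesr => m _; rewrite -EFinM powRM ?exprn_ge0 ?(ltW d0)//.
  congr (_ * _)%:E.
  by rewrite -!powR_mulrn ?powR_ge0 ?(ltW d0)// -!powRrM mulrC.
under eq_eseriesr do rewrite E.
case: Y Y0 {E} => [Y| |]// Y0; last first.
  by rewrite gt0_muley ?leey// lte_fin invr_gt0 subr_gt0; case/andP: dr.
under eq_eseriesr do rewrite -EFinM mulrC.
rewrite -EFinM mulrC.
exact: geometric_nneseries_le.
Qed.

(* The function is the power g of min (u / t) (t / u). *)
Lemma lqnorm_log_peak r (g : R) : (0 < r)%E -> 0 < g ->
  exists2 C : R, 0 < C & forall t, 0 < t ->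
    (lqnorm r `]0%R, +oo[
      (fun u => (u `^ (- rinv r) * expR (- g * `|ln u - ln t|))%:E) <= C%:E)%E.
Proof.
move=> r0 g0.
(* For [u] between [t * 2 ^ k] and [t * 2 ^ (k + 1)] the distance from [ln u] to [ln t] is at least
   [(|k| - 1) * ln 2]; the loss of 1 comes from negative [k]. *)
pose y (k : int) : R := expR (g * ln 2 * (1 - `|k%:~R|)).
have l2 : 0 < ln 2 :> R by rewrite ln_gt0// ltr1n.
have [C1 C10 HC1] : exists2 C1 : R, 0 < C1 & (ell r y <= C1%:E)%E.
  case: r r0 => [r| |]// r0; last first.
    exists (expR (g * ln 2)); first exact: expR_gt0.
    apply: ge_ereal_sup => _ [k _ <-]; rewrite lee_fin ler_expR.
    rewrite ler_piMr ?mulr_ge0 ?(ltW g0) ?(ltW l2)// lerBlDr lerDl normr_ge0//.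
  (* The factor 1/2 reflects that the integer of rank [n] has absolute value at least [n / 2]. *)
  pose q := expR (- (g * ln 2 / 2 * r)).
  have q01 : 0 < q < 1.
    by rewrite expR_gt0/= expR_lt1 oppr_lt0 !mulr_gt0.
  exists ((expR (g * ln 2 * r) / (1 - q)) `^ r^-1).
    by rewrite powR_gt0// divr_gt0 ?expR_gt0// subr_gt0; case/andP: q01.
  rewrite /ell -poweR_EFin; apply: le_poweR.
  - by rewrite invr_ge0 ltW.
  - by apply: esum_ge0 => k _; rewrite lee_fin powR_ge0.
  rewrite esum_int; last by move=> k; rewrite lee_fin powR_ge0.
  apply: le_trans (geometric_nneseries_le _ q01); last exact: expR_ge0.
  apply: lee_nneseries => [n _ _|n _]; first by rewrite lee_fin powR_ge0.
  rewrite lee_fin /y /q -expRM_natr -expRD -expRM ler_expR.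
  rewrite -subr_ge0.
  have -> : g * ln 2 * r + - (g * ln 2 / 2 * r) * n%:R
     - g * ln 2 * (1 - `|(int_of_rank n)%:~R|) * r =
     g * ln 2 * r * (`|(int_of_rank n)%:~R| - n%:R / 2) by field.
  apply: mulr_ge0; first by rewrite !mulr_ge0// ltW.
  rewrite -intr_norm subr_ge0 ler_pdivrMr//.
  rewrite -[2]/(2%:~R) -intrM -[n%:R]/(n%:Z%:~R) ler_int /int_of_rank.
  by case: ifPn; lia.
exists (2 `^ rinv r * C1); first by rewrite mulr_gt0// powR_gt0.
move=> t t0; rewrite EFinM.
have vD : cells 2 (fun k : int => t * 2 `^ k%:~R).
  move=> k; split; first by rewrite mulr_gt0// powR_gt0.
  - rewrite intrD powRD ?pnatr_eq0 ?implybT// powRr1//.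
    by rewrite (_ : t * (_ * 2) = 2 * (t * 2 `^ k%:~R))//; ring.
  - rewrite intrD powRD ?pnatr_eq0 ?implybT// powRr1//.
    by rewrite (_ : t * (_ * 2) = 2 * (t * 2 `^ k%:~R))//; ring.
apply: le_trans (lqnorm_le_ell r0 vD (y := y) _) _; last first.
  by apply: lee_wpmul2l => //; rewrite lee_fin powR_ge0.
move=> k u /andP[ku uk]; rewrite expR_ge0/= ler_expR.
have p2 : 0 < t * 2 `^ k%:~R by rewrite mulr_gt0// powR_gt0.
have u0 : 0 < u by exact: lt_trans ku.
have : ln (t * 2 `^ k%:~R) <= ln u by rewrite ler_ln ?posrE// ltW.
have : ln u <= ln (t * 2 `^ (k + 1)%:~R).
  by rewrite ler_ln ?posrE// mulr_gt0// powR_gt0.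
rewrite !lnM ?posrE ?powR_gt0// !ln_powR intrD.
set K : R := k%:~R; set L := ln 2 in l2 *; move=> h1 h2.
rewrite -subr_ge0.
have -> : g * L * (1 - `|K|) - - g * `|ln u - ln t| =
  g * (L * (1 - `|K|) + `|ln u - ln t|) by ring.
apply: mulr_ge0; first exact: ltW.
have [k0|k0] := leP 0 K.
  rewrite (ger0_norm k0); have := ler_norm (ln u - ln t); nra.
rewrite (ltr0_norm k0); have := ler_norm (- (ln u - ln t)); rewrite normrN; nra.
Qed.

End Discretization.

(** * Regular variation *)

(* Potter's bounds in logarithmic form; slow variation is the index 0. *)
Definition regvar (R : realType) (alpha : R) (F : R -> R) : Prop :=
  pos_fun F /\ forall e : R, 0 < e -> exists c : R,
    forall s t : R, 0 < s -> 0 < t ->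
      ln (F s) - ln (F t) <= alpha * (ln s - ln t) + c + e * `|ln s - ln t|.

Section RegularVariation.
Context (R : realType).
Implicit Types (F G b : R -> R) (alpha beta p : R).

(** The increasing function equivalent to [t ^ e * b t] gives [b s <= C1 ^ 2 * (t / s) ^ e * b t]
    for [s <= t]; the decreasing one gives the symmetric bound for [s > t]. *)
Lemma SV_regvar b : SV b -> regvar 0 b.
Proof.
case=> b0 _ H; split=> // e e0.
have [[phi [p0 ph [C1 C10 Hp]]] [psi [q0 qh [C2 C20 Hq]]]] := H e e0.
exists (`|2 * ln C1| + `|2 * ln C2|) => s t s0 t0; rewrite mul0r add0r.
have bs := b0 _ s0; have bt := b0 _ t0.
have h1 := ler_norm (2 * ln C1); have h2 := ler_norm (2 * ln C2).
have n1 := normr_ge0 (2 * ln C1); have n2 := normr_ge0 (2 * ln C2).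
have [st|ts] := leP s t.
  have [H1 _] := Hp _ s0; have [_ H2] := Hp _ t0.
  have H3 : phi s <= phi t by apply: ph; rewrite ?in_itv ?andbT.
  have L : ln s <= ln t by rewrite ler_ln.
  have : ln (s `^ e * b s) <= ln (C1 * (C1 * (t `^ e * b t))).
    rewrite ler_ln ?posrE ?mulr_gt0 ?powR_gt0//.
    apply: (le_trans H1); rewrite ler_pM2l//; exact: le_trans H2.
  rewrite !lnM ?posrE ?mulr_gt0 ?powR_gt0// !ln_powR => H4.
  rewrite (@ler0_norm _ (ln s - ln t)) ?subr_le0//; lra.
have [H1 _] := Hq _ s0; have [_ H2] := Hq _ t0.
have H3 : psi s <= psi t by apply: qh; rewrite ?in_itv ?andbT// ltW.
have L : ln t < ln s by rewrite ltr_ln.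
have : ln (s `^ (- e) * b s) <= ln (C2 * (C2 * (t `^ (- e) * b t))).
  rewrite ler_ln ?posrE ?mulr_gt0 ?powR_gt0//.
  apply: (le_trans H1); rewrite ler_pM2l//; exact: le_trans H2.
rewrite !lnM ?posrE ?mulr_gt0 ?powR_gt0// !ln_powR => H4.
rewrite (@gtr0_norm _ (ln s - ln t)) ?subr_gt0//; lra.
Qed.

Lemma eq_regvar alpha F G : (forall t, 0 < t -> F t = G t) ->
  regvar alpha F -> regvar alpha G.
Proof.
move=> FG [F0 HF]; split=> [t t0|e e0]; first by rewrite -FG ?F0.
by have [c Hc] := HF e e0; exists c => s t s0 t0; rewrite -!FG//; exact: Hc.
Qed.

Lemma regvar_powR_id p : regvar p (fun t : R => t `^ p).
Proof.
split=> [t t0|e e0]; first exact: powR_gt0.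
exists 0 => s t s0 t0; rewrite !ln_powR addr0 -mulrBr lerDl.
by rewrite mulr_ge0// ltW.
Qed.

Lemma regvarM alpha beta F G : regvar alpha F -> regvar beta G ->
  regvar (alpha + beta) (fun t => F t * G t).
Proof.
move=> [F0 HF] [G0 HG]; split=> [t t0|e e0]; first by rewrite mulr_gt0 ?F0 ?G0.
have e2 : 0 < e / 2 by rewrite divr_gt0.
have [c1 H1] := HF _ e2; have [c2 H2] := HG _ e2.
exists (c1 + c2) => s t s0 t0; rewrite !lnM ?posrE ?F0 ?G0//.
have := H1 s t s0 t0; have := H2 s t s0 t0; lra.
Qed.

(** Exchanging [s] and [t] in the upper bound yields the lower bound. *)
Lemma regvar_abs alpha F e : regvar alpha F -> 0 < e -> exists c : R,
  forall s t : R, 0 < s -> 0 < t ->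
    `|ln (F s) - ln (F t) - alpha * (ln s - ln t)| <= c + e * `|ln s - ln t|.
Proof.
move=> [F0 HF] e0; have [c Hc] := HF e e0; exists c => s t s0 t0.
have H1 := Hc s t s0 t0; have H2 := Hc t s t0 s0.
by rewrite distrC in H2; rewrite ler_norml; apply/andP; split; lra.
Qed.

Lemma regvar_powR alpha F p : regvar alpha F ->
  regvar (p * alpha) (fun t => F t `^ p).
Proof.
move=> HF; have F0 := HF.1; split=> [t t0|e e0]; first by rewrite powR_gt0// F0.
(* Adding 1 allows division also when [p = 0]. *)
have p1 : 0 < `|p| + 1 by have := normr_ge0 p; lra.
have [c Hc] := regvar_abs HF (divr_gt0 e0 p1).
exists (`|p| * c) => s t s0 t0; rewrite !ln_powR.
have := Hc s t s0 t0; set d := _ - _ - _ => H.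
have -> : p * ln (F s) - p * ln (F t) = p * d + p * alpha * (ln s - ln t).
  by rewrite /d; ring.
rewrite addrC -!addrA lerD2l; apply: le_trans (ler_norm _) _.
rewrite normrM; apply: le_trans (_ : `|p| * (c + e / (`|p| + 1) * `|ln s - ln t|) <= _).
  exact: ler_wpM2l.
rewrite mulrDr lerD2l mulrA ler_wpM2r// mulrCA ler_piMr ?ltW//.
rewrite ltr_pdivrMr//; lra.
Qed.

Lemma regvarV alpha F : regvar alpha F -> regvar (- alpha) (fun t => (F t)^-1).
Proof.
move=> HF; rewrite -mulN1r.
apply: eq_regvar (regvar_powR (-1) HF) => t t0.
by rewrite powR_inv1// ltW// HF.1.
Qed.

(** Half of [e] pays for the Potter error of [G], measured by [|ln (F s) - ln (F t)|], which is at
    most [(|alpha| + 1) * |ln s - ln t|] plus a constant. The other half pays for the error of [F],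
    multiplied by [|beta|]. *)
Lemma regvar_comp alpha beta F G : regvar alpha F -> regvar beta G ->
  regvar (beta * alpha) (fun t => G (F t)).
Proof.
move=> HF HG; have F0 := HF.1; split=> [t t0|e e0]; first by apply: HG.1; exact: F0.
pose A : R := `|alpha| + 1; have A1 : 1 <= A by have := normr_ge0 alpha; rewrite /A; lra.
have A0 : 0 < A by lra.
pose B : R := `|beta| + 1; have B1 : 1 <= B by have := normr_ge0 beta; rewrite /B; lra.
have B0 : 0 < B by lra.
have e2 : 0 < e / 2 by rewrite divr_gt0.
have [c1 H1] := HG.2 _ (divr_gt0 e2 A0).
have [c2 H2] := regvar_abs HF (divr_gt0 e2 B0).
have [c3 H3] := regvar_abs HF ltr01.
exists (c1 + `|beta| * c2 + e / 2 / A * c3) => s t s0 t0.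
have h1 := H1 _ _ (F0 s s0) (F0 t t0).
have h2 := H2 s t s0 t0; have h3 := H3 s t s0 t0.
set x := ln s - ln t in h2 h3 *; set y := ln (F s) - ln (F t) in h1 h2 h3 *.
apply: (le_trans h1).
have k1 : beta * y <= beta * alpha * x + `|beta| * (c2 + e / 2 / B * `|x|).
  have -> : beta * y = beta * alpha * x + beta * (y - alpha * x) by ring.
  rewrite lerD2l; apply: le_trans (ler_norm _) _; rewrite normrM.
  exact: ler_wpM2l.
have k2 : `|y| <= A * `|x| + c3.
  have : `|y| <= `|y - alpha * x| + `|alpha * x|.
    by apply: le_trans (ler_normD _ _); rewrite subrK.
  rewrite normrM /A; lra.
have k3 : e / 2 / A * `|y| <= e / 2 / A * (A * `|x| + c3).
  by apply: ler_wpM2l => //; rewrite ltW// divr_gt0.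
have k4 : e / 2 / A * (A * `|x| + c3) = e / 2 * `|x| + e / 2 / A * c3.
  by field; rewrite gt_eqF.
have k5 : `|beta| * (e / 2 / B * `|x|) <= e / 2 * `|x|.
  rewrite mulrA; apply: ler_wpM2r => //.
  rewrite mulrCA ler_piMr ?(ltW e2)// ler_pdivrMr// mul1r /B lerDl//.
rewrite (mulrDr `|beta|) in k1; move: k1 k3 k4 k5.
move: (e / 2 / A * (A * `|x| + c3)) (e / 2 / A * `|y|) (e / 2 / A * c3).
move: (`|beta| * (e / 2 / B * `|x|)) (beta * alpha * x) (`|beta| * c2) (beta * y).
move=> *; lra.
Qed.

(** The two conditions on [s] and [t] bound [|ln s - ln t|] by [ln D]. *)
Lemma regvar_comparable alpha F (D : R) : regvar alpha F -> 1 <= D ->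
  exists2 C : R, 0 < C & forall s t : R, 0 < s -> 0 < t -> s <= D * t -> t <= D * s ->
    F s <= C * F t.
Proof.
move=> [F0 HF] D1; have [c Hc] := HF 1 ltr01.
have D0 : 0 < D by lra.
exists (expR (`|alpha| * ln D + c + ln D)); first exact: expR_gt0.
move=> s t s0 t0 st ts.
have Ft := F0 t t0; have Fs := F0 s s0.
have D2 : 0 <= ln D by rewrite ln_ge0.
have h1 : ln s <= ln D + ln t by rewrite -lnM ?posrE// ler_ln ?posrE ?mulr_gt0.
have h2 : ln t <= ln D + ln s by rewrite -lnM ?posrE// ler_ln ?posrE ?mulr_gt0.
have h3 : `|ln s - ln t| <= ln D by rewrite ler_norml; lra.
have h4 : alpha * (ln s - ln t) <= `|alpha| * ln D.
  apply: le_trans (ler_norm _) _; rewrite normrM; exact: ler_wpM2l.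
rewrite -ler_ln ?posrE ?mulr_gt0 ?expR_gt0// lnM ?posrE ?expR_gt0// expRK.
have := Hc s t s0 t0; lra.
Qed.

End RegularVariation.

(** * Primitives of slowly varying functions *)

Section Blocks.
Context (R : realType).
Implicit Types (q r : \bar R) (F : R -> R) (I : interval R).

(** The block []t, 2 * t]] is the cell of index 0 of the dyadic partition through [t]. The bound is
    [ell_le_lqnorm] for a sequence supported at 0, with [F] extended by 0. *)
Lemma lqnorm_block q I F (t c : R) : (0 < q)%E -> 0 < t -> 0 <= c ->
  {in I, forall u, 0 <= F u} ->
  (forall u, t < u <= 2 * t -> u \in I /\ c <= F u) ->
  (c%:E <= (2 `^ rinv q)%:E * lqnorm q I (fun u => (u `^ (- rinv q) * F u)%:E))%E.
Proof.
move=> q0 t0 c0 F0 H.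
have vD : cells 2 (fun k : int => t * 2 `^ k%:~R).
  move=> k; split; first by rewrite mulr_gt0// powR_gt0.
  - rewrite intrD powRD ?pnatr_eq0 ?implybT// powRr1//.
    by rewrite (_ : t * (_ * 2) = 2 * (t * 2 `^ k%:~R))//; ring.
  - rewrite intrD powRD ?pnatr_eq0 ?implybT// powRr1//.
    by rewrite (_ : t * (_ * 2) = 2 * (t * 2 `^ k%:~R))//; ring.
pose y (k : int) : R := if k == 0 then c else 0.
pose F' u : R := if u \in I then F u else 0.
have y0 k : 0 <= y k by rewrite /y; case: ifP.
have yF k u : t * 2 `^ k%:~R < u <= t * 2 `^ (k + 1)%:~R -> y k <= F' u.
  rewrite /y /F'; case: eqP => [->|_ _]; last by case: ifPn => // /F0.
  rewrite powRr0 mulr1 add0r powRr1// mulrC => /H[-> //].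
have cell : (c%:E <= ell q y)%E.
  rewrite /ell; case: q q0 {H} => [q| |]// q0; last first.
    by apply: ereal_sup_ubound; exists 0; rewrite // /y eqxx.
  rewrite esum_int; last by move=> k; rewrite lee_fin powR_ge0.
  have q1 : 0 <= q^-1 by rewrite invr_ge0 ltW.
  rewrite -[c in leLHS](powRr1 c0) -(divff (lt0r_neq0 q0)) powRrM -poweR_EFin.
  apply: le_poweR; rewrite ?lee_fin ?powR_ge0//.
  have yc : c = y (int_of_rank 0) by rewrite /y eqxx.
  rewrite [c in leLHS]yc.
  apply: (nneseries_ge_term (u := fun n => (y (int_of_rank n) `^ q)%:E)) => i.
  by rewrite lee_fin powR_ge0.
apply: (le_trans cell); apply: (le_trans (ell_le_lqnorm q0 vD y0 yF)).
apply: lee_wpmul2l; first by rewrite lee_fin powR_ge0.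
apply: lqnorm_le => // u _ uI; rewrite /F'; last by rewrite (negbTE uI) mulr0.
by rewrite uI lexx andbT lee_fin mulr_ge0 ?powR_ge0 ?F0.
Qed.

Lemma ge0_lqnorm_scale_le q I F G (k : R) : (0 < q)%E -> 0 < k ->
  {in I, forall u, 0 <= F u <= k * G u} ->
  (lqnorm q I (fun u => (u `^ (- rinv q) * F u)%:E) <=
   k%:E * lqnorm q I (fun u => (u `^ (- rinv q) * G u)%:E))%E.
Proof.
move=> q0 k0 FG.
have G0 : {in I, forall u, 0 <= G u}.
  move=> u /FG/andP[F0 /(le_trans F0)]; by rewrite pmulr_rge0.
rewrite -lqnorm_scale//; last first.
  by move=> u uI; rewrite lee_fin mulr_ge0 ?powR_ge0 ?G0.
apply: lqnorm_mono => // u uI; have /andP[F0 FGu] := FG _ uI.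
rewrite lee_fin mulr_ge0 ?powR_ge0//= -EFinM lee_fin mulrCA.
by apply: ler_wpM2l => //; exact: powR_ge0.
Qed.

Section Primitive.
Variables (r : \bar R) (b : R -> R).
Hypotheses (r0 : (0 < r)%E) (hb : regvar 0 b).

Let N (t : R) := lqnorm r `]0, t[ (fun s => (s `^ (- rinv r) * b s)%:E).

Hypothesis N1 : (N 1 < +oo)%E.

Lemma primitive_mono s t : s <= t -> (N s <= N t)%E.
Proof.
move=> st; apply: lqnorm_mono => // u; rewrite !in_itv/= => /andP[u0 us].
  by rewrite u0/= (lt_le_trans us).
by rewrite lexx andbT lee_fin mulr_ge0 ?powR_ge0// ltW// hb.1.
Qed.

Lemma primitive_ge : exists2 C : R, 0 < C &
  forall t, 0 < t -> ((b t)%:E <= C%:E * N t)%E.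
Proof.
have [C C0 HC] := regvar_comparable hb (ler1n _ 4 : 1 <= 4%:R).
exists (C * 2 `^ rinv r); first by rewrite mulr_gt0// powR_gt0.
move=> t t0.
have bt := hb.1 _ t0.
(* Starting at [t / 4] keeps the block inside the open interval []0, t[]. *)
have := @lqnorm_block r `]0, t[ b (t / 4) (C^-1 * b t) r0.
have t4 : 0 < t / 4 by rewrite divr_gt0.
rewrite t4 => /(_ isT); rewrite mulr_ge0 ?invr_ge0 ?(ltW C0) ?(ltW bt)// => /(_ isT).
move=> H; rewrite EFinM -muleA -lee_pdivrMl// -EFinM; apply: H.
  by move=> u; rewrite in_itv/= => /andP[u0 _]; rewrite ltW// hb.1.
move=> u /andP[u1 u2].
have u0 : 0 < u by exact: lt_trans u1.
split; first by rewrite in_itv/= u0/=; lra.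
by rewrite mulrC ler_pdivrMr// mulrC; apply: HC => //; lra.
Qed.

(** The norm is split at [s]. For [u] in [[s, t[], Potter's bound with [e / 2] controls [b u] by a
    multiple of [b s * (t / s) ^ e * (u / s) ^ (- e / 2)]. The last factor has a bounded norm, and
    [b s] is at most a multiple of [N s]. *)
Lemma primitive_growth e : 0 < e -> exists2 C : R, 0 < C &
  forall s t, 0 < s -> s <= t ->
    (N t <= (C * expR (e * (ln t - ln s)))%:E * N s)%E.
Proof.
move=> e0.
have [C1 C10 HC1] := primitive_ge.
have [C2 C21 HC2] := @lqnorm_split R r r0.
have e2 : 0 < e / 2 by rewrite divr_gt0.
have [c Hc] := hb.2 _ e2.
have [C3 C30 HC3] := lqnorm_log_peak r0 e2.
have C20 : 0 < C2 by lra.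
exists (C2 * (1 + expR c * C3 * C1)).
  by rewrite mulr_gt0// addr_gt0// !mulr_gt0// expR_gt0.
move=> s t s0 st; have t0 : 0 < t by exact: lt_le_trans st.
set E := expR (e * _).
have E1 : 1 <= E.
  by rewrite -expR0 ler_expR mulr_ge0// ?(ltW e0)// subr_ge0 ler_ln.
apply: (@le_trans _ _ (C2%:E * (N s + lqnorm r `[s, t[
    (fun s => (s `^ (- rinv r) * b s)%:E)))%E).
  apply: HC2 => u; rewrite !in_itv/= => /andP[u0 ut].
    by rewrite u0 ut /= andbT; case: ltP.
  by rewrite lee_fin mulr_ge0 ?powR_ge0// ltW// hb.1.
have H : (lqnorm r `[s, t[ (fun s => (s `^ (- rinv r) * b s)%:E) <=
    (expR c * E * C3)%:E * (b s)%:E)%E.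
  apply: (@le_trans _ _ ((b s * expR c * E)%:E * lqnorm r `[s, t[
     (fun u => (u `^ (- rinv r) * expR (- (e / 2) * `|ln u - ln s|))%:E))%E).
    apply: ge0_lqnorm_scale_le => //.
      by rewrite !mulr_gt0 ?expR_gt0// hb.1.
    move=> u; rewrite in_itv/= => /andP[su ut].
    have u0 : 0 < u by exact: lt_le_trans su.
    have bu := hb.1 _ u0; have bs := hb.1 _ s0.
    rewrite (ltW bu)/= -[b u]lnK ?posrE// -[b s]lnK ?posrE// -!expRD ler_expR.
    have := Hc _ _ u0 s0.
    have L1 : ln s <= ln u by rewrite ler_ln.
    have L2 : ln u <= ln t by rewrite ler_ln// ltW.
    rewrite ger0_norm ?subr_ge0//.
    have : e * ln u <= e * ln t by rewrite ler_pM2l.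
    lra.
  rewrite -EFinM (_ : expR c * E * C3 * b s = b s * expR c * E * C3); last ring.
  rewrite [X in (_ <= X)%E]EFinM; apply: lee_wpmul2l.
    by rewrite lee_fin !mulr_ge0 ?expR_ge0// ltW// hb.1.
  apply: le_trans (HC3 s s0); apply: lqnorm_mono => //.
    by move=> u; rewrite !in_itv/= andbT => /andP[+ _]; exact: lt_le_trans.
  by move=> u _; rewrite lexx andbT lee_fin mulr_ge0 ?powR_ge0 ?expR_ge0.
rewrite -mulrA EFinM -muleA; apply: lee_wpmul2l.
  by rewrite lee_fin ltW.
rewrite mulrDl mul1r EFinD ge0_muleDl ?lee_fin ?expR_ge0//; last first.
  by rewrite !mulr_ge0 ?expR_ge0// ltW.
apply: leeD.
  by rewrite -[leLHS]mul1e; apply: lee_wpmul2r; rewrite ?lqnorm_ge0 ?lee_fin.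
apply: (le_trans H).
rewrite (_ : expR c * C3 * C1 * E = expR c * E * C3 * C1); last ring.
rewrite [in leRHS]EFinM -muleA; apply: lee_wpmul2l; last exact: HC1.
by rewrite lee_fin !mulr_ge0 ?expR_ge0// ltW.
Qed.

Lemma primitive_fin t : 0 < t -> (N t < +oo)%E.
Proof.
move=> t0; have [C C0 HC] := primitive_growth ltr01.
have [t1|t1] := leP t 1; first exact: le_lt_trans (primitive_mono t1) N1.
apply: le_lt_trans (HC _ _ ltr01 (ltW t1)) _.
by rewrite lte_mul_pinfty// lee_fin mulr_ge0 ?expR_ge0// ltW.
Qed.

Lemma primitive_fineK t : 0 < t -> ((fine (N t))%:E = N t)%E.
Proof.
move=> t0; apply: fineK; rewrite ge0_fin_numE; first exact: primitive_fin.
exact: lqnorm_ge0.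
Qed.

(** Monotonicity of [N] covers [s <= t], and [primitive_growth] covers [s > t]. *)
Lemma primitive_regvar : regvar 0 (fun t => fine (N t)).
Proof.
have B0 t : 0 < t -> 0 < fine (N t).
  move=> t0; have [C C0 HC] := primitive_ge.
  have := HC t t0; rewrite -primitive_fineK// -EFinM lee_fin => H.
  by rewrite -(pmulr_rgt0 _ C0); apply: lt_le_trans H; exact: hb.1.
split=> // e e0; have [C C0 HC] := primitive_growth e0.
exists `|ln C| => s t s0 t0; rewrite mul0r add0r.
have Bs := B0 _ s0; have Bt := B0 _ t0.
have [st|ts] := leP s t.
  have : ln (fine (N s)) <= ln (fine (N t)).
    by rewrite ler_ln// -lee_fin !primitive_fineK//; exact: primitive_mono.
  rewrite -subr_le0; move/le_trans; apply.
  by rewrite addr_ge0// mulr_ge0// ltW.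
have := HC _ _ t0 (ltW ts).
rewrite -(primitive_fineK s0) -(primitive_fineK t0) -EFinM lee_fin => H.
have : ln (fine (N s)) <= ln (C * expR (e * (ln s - ln t)) * fine (N t)).
  by rewrite ler_ln ?posrE ?mulr_gt0 ?expR_gt0.
rewrite !lnM ?posrE ?mulr_gt0 ?expR_gt0// expRK.
have := ler_norm (ln C); have := ler_norm (ln s - ln t).
move=> h1 h2 h3; have : e * (ln s - ln t) <= e * `|ln s - ln t| by rewrite ler_pM2l.
lra.
Qed.

End Primitive.

End Blocks.

(** * The K-functional *)

Section Kfunctional.
Context (R : realType) (V : lmodType R) (X0 X1 : qspace V).
(** Stated for nonnegative functionals so that the section serves both the couple (A0, A1) and the
    couple formed by the R-space and A1. *)
Hypothesis X0_ge0 : forall f, carrier X0 f -> 0 <= qnorm X0 f.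
Hypothesis X1_ge0 : forall f, carrier X1 f -> 0 <= qnorm X1 f.

Lemma Kfun_le t f0 f1 : 0 <= t -> carrier X0 f0 -> carrier X1 f1 ->
  Kfun X0 X1 t (f0 + f1) <= qnorm X0 f0 + t * qnorm X1 f1.
Proof.
move=> t0 c0 c1; apply: ge_inf; last by exists f0, f1.
exists 0 => _ [g0 [g1 [h0 h1 _ ->]]].
by rewrite addr_ge0 ?mulr_ge0 ?X0_ge0 ?X1_ge0.
Qed.

Lemma Kfun_ge t f c : sum_space X0 X1 f ->
  (forall f0 f1, carrier X0 f0 -> carrier X1 f1 -> f = f0 + f1 ->
     c <= qnorm X0 f0 + t * qnorm X1 f1) -> c <= Kfun X0 X1 t f.
Proof.
move=> [f0 [f1 [c0 c1 ff]]] H; apply: lb_le_inf.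
  by exists (qnorm X0 f0 + t * qnorm X1 f1), f0, f1.
by move=> _ [g0 [g1 [h0 h1 gg ->]]]; exact: H.
Qed.

Lemma Kfun_ge0 t f : 0 <= t -> sum_space X0 X1 f -> 0 <= Kfun X0 X1 t f.
Proof.
move=> t0 sf; apply: Kfun_ge => // f0 f1 c0 c1 _.
by rewrite addr_ge0 ?mulr_ge0 ?X0_ge0 ?X1_ge0.
Qed.

Lemma Kfun_mono s t f : 0 <= s -> s <= t -> sum_space X0 X1 f ->
  Kfun X0 X1 s f <= Kfun X0 X1 t f.
Proof.
move=> s0 st sf; apply: Kfun_ge => // f0 f1 c0 c1 ->.
apply: le_trans (Kfun_le s0 c0 c1) _.
by rewrite lerD2l ler_wpM2r ?X1_ge0.
Qed.

Lemma Kfun_quasiconcave s t f : 0 < s -> s <= t -> sum_space X0 X1 f ->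
  Kfun X0 X1 t f <= t / s * Kfun X0 X1 s f.
Proof.
move=> s0 st sf; have t0 : 0 < t by exact: lt_le_trans st.
rewrite mulrC -ler_pdivrMr ?divr_gt0//; apply: Kfun_ge => // f0 f1 c0 c1 ->.
rewrite ler_pdivrMr ?divr_gt0//; apply: le_trans (Kfun_le (ltW t0) c0 c1) _.
rewrite mulrDl lerD//.
  by rewrite ler_peMr ?X0_ge0// ler_pdivlMr// mul1r.
by rewrite mulrAC mulrCA divff ?mulr1 ?gt_eqF.
Qed.

Lemma Kfun_approx t f e : 0 <= t -> sum_space X0 X1 f -> 0 < e ->
  exists f0 f1, [/\ carrier X0 f0, carrier X1 f1, f = f0 + f1 &
    qnorm X0 f0 + t * qnorm X1 f1 < Kfun X0 X1 t f + e].
Proof.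
move=> t0 [f0 [f1 [c0 c1 ff]]] e0.
set S := [set x | exists f0 f1, [/\ carrier X0 f0, carrier X1 f1, f = f0 + f1 &
                                 x = qnorm X0 f0 + t * qnorm X1 f1]].
have iS : has_inf S.
  split; first by exists (qnorm X0 f0 + t * qnorm X1 f1), f0, f1.
  exists 0 => _ [g0 [g1 [h0 h1 _ ->]]].
  by rewrite addr_ge0 ?mulr_ge0 ?X0_ge0 ?X1_ge0.
have [_ [g0 [g1 [h0 h1 gg ->]]] H] := inf_adherent e0 iS.
by exists g0, g1.
Qed.

End Kfunctional.

Section QuasiBanach.
Context (R : realType) (V : lmodType R) (X : qspace V).
Hypothesis qX : quasi_banach X.

Lemma qnorm0 : qnorm X 0 = 0.
Proof.
by rewrite -[in LHS](scale0r 0) (qb_homog qX) ?normr0 ?mul0r//; exact: qb_zero.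
Qed.

Lemma carrierN f : carrier X f -> carrier X (- f).
Proof. by move=> cf; rewrite -scaleN1r; exact: (qb_scale qX). Qed.

Lemma qnormN f : carrier X f -> qnorm X (- f) = qnorm X f.
Proof. by move=> cf; rewrite -scaleN1r (qb_homog qX)// normrN1 mul1r. Qed.

End QuasiBanach.

Section CompatibleCouple.
Context (R : realType) (V : topologicalLmodType R) (A0 A1 : qspace V).
Hypothesis cA : compatible_couple A0 A1.

Let q0 : quasi_banach A0. Proof. by case: cA. Qed.
Let q1 : quasi_banach A1. Proof. by case: cA. Qed.

(** Such an [f] has decompositions with both terms arbitrarily small. By continuity of the
    inclusions and of addition it lies in every neighbourhood of 0, and the ambient space is
    Hausdorff. *)
Lemma Kfun_eq0 t f : 0 < t -> sum_space A0 A1 f -> Kfun A0 A1 t f = 0 -> f = 0.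
Proof.
move=> t0 sf K0; have [hV _ _ i0 i1] := cA.
suff H U : nbhs (0 : V) U -> U f.
  by apply/esym/hV => A B /H Af Bf; exists f; split=> //; exact: nbhs_singleton.
move=> U0.
have [[U1 U2] /= [n1 n2] U12] : nbhs ((0, 0) : V * V) ((fun z => z.1 + z.2) @^-1` U).
  by apply: (@add_continuous V (0, 0)); rewrite /= addr0.
have [e1 e10 H1] := i0 _ n1; have [e2 e20 H2] := i1 _ n2.
have e0 : 0 < Num.min e1 (t * e2) by rewrite lt_min e10 mulr_gt0.
have [f0 [f1 [c0 c1 ff]]] :=
  Kfun_approx (qb_ge0 q0) (qb_ge0 q1) (ltW t0) sf e0.
rewrite K0 add0r lt_min => /andP[h1 h2].
have p0 := qb_ge0 q0 c0; have p1 : 0 <= t * qnorm A1 f1.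
  by rewrite mulr_ge0 ?(ltW t0)// (qb_ge0 q1).
rewrite ff; apply: (U12 (f0, f1)); split => /=.
- by apply: H1 => //; lra.
- apply: H2 => //; rewrite -(ltr_pM2l t0); lra.
Qed.

(** In any decomposition of [g], the vector [h] is added to the component in [A1]. *)
Lemma Kfun_add_ge C t g h : 0 <= t -> 1 <= C ->
  (forall f g, carrier A1 f -> carrier A1 g ->
      qnorm A1 (f + g) <= C * (qnorm A1 f + qnorm A1 g)) ->
  sum_space A0 A1 g -> carrier A1 h ->
  Kfun A0 A1 t (g + h) <= C * (Kfun A0 A1 t g + t * qnorm A1 h).
Proof.
move=> t0 C1 HC sg ch; have C0 : 0 < C by lra.
rewrite -ler_pdivrMl// -lerBlDr; apply: Kfun_ge => // g0 g1 c0 c1 ->.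
rewrite lerBlDr ler_pdivrMl// -addrA.
have n0 := qb_ge0 q0 c0; have n1 := qb_ge0 q1 c1; have n2 := qb_ge0 q1 ch.
apply: le_trans (Kfun_le (qb_ge0 q0) (qb_ge0 q1) t0 c0 (qb_add q1 c1 ch)) _.
apply: (@le_trans _ _ (qnorm A0 g0 + t * (C * (qnorm A1 g1 + qnorm A1 h)))).
  by rewrite lerD2l ler_wpM2l// HC.
rewrite -addrA -mulrDr [leRHS]mulrDr mulrCA lerD2r.
by rewrite ler_peMl.
Qed.

Lemma sum_space_carrierl f : carrier A0 f -> sum_space A0 A1 f.
Proof. by move=> c0; exists f, 0; split=> //; [exact: qb_zero|rewrite addr0]. Qed.

(** Take a decomposition optimal up to a factor 2 at [t]. For [u > t], K(u, f0) is at most the norm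
    of [f0]. For [u <= t], [f0 = f - f1], and quasi-concavity bounds [u] times the norm of [f1] by 2
    K(u, f). *)
Lemma Kfun_truncation : exists2 C : R, 0 < C &
  forall t f, 0 < t -> sum_space A0 A1 f -> exists f0 f1,
  [/\ carrier A0 f0, carrier A1 f1, f = f0 + f1,
      qnorm A0 f0 + t * qnorm A1 f1 <= 2 * Kfun A0 A1 t f &
      forall u, 0 < u -> Kfun A0 A1 u f0 <= C * Kfun A0 A1 (Num.min u t) f].
Proof.
have [C C1 HC] := qb_triangle q1.
have C0 : 0 < C by lra.
exists (3 * C); first by lra.
move=> t f t0 sf.
have p0 := qb_ge0 q0; have p1 := qb_ge0 q1.
have [f0 [f1 [c0 c1 ff H]]] : exists f0 f1, [/\ carrier A0 f0, carrier A1 f1,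
    f = f0 + f1 & qnorm A0 f0 + t * qnorm A1 f1 <= 2 * Kfun A0 A1 t f].
  (* If K(t, f) = 0 the infimum leaves no room for a factor 2, but then [f = 0] and the zero
     decomposition works. *)
  have := Kfun_ge0 p0 p1 (ltW t0) sf; rewrite le_eqVlt => /predU1P[/esym K0|K0].
    exists 0, 0; split; [exact: qb_zero|exact: qb_zero| |].
      by rewrite addr0 (Kfun_eq0 t0 sf K0).
    by rewrite !qnorm0// K0 !mulr0 addr0.
  have [f0 [f1 [c0 c1 ff H]]] := Kfun_approx p0 p1 (ltW t0) sf K0.
  by exists f0, f1; split=> //; lra.
exists f0, f1; split=> // u u0.
have n0 := p0 _ c0; have n1 := p1 _ c1.
have [ut|tu] := leP u t; last first.
  rewrite -[f0 in leLHS]addr0.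
  apply: le_trans (Kfun_le p0 p1 (ltW u0) c0 (qb_zero q1)) _.
  rewrite qnorm0// mulr0 addr0.
  have K0 := Kfun_ge0 p0 p1 (ltW t0) sf.
  have tn : 0 <= t * qnorm A1 f1 by rewrite mulr_ge0// ltW.
  apply: (@le_trans _ _ (2 * Kfun A0 A1 t f)); first lra.
  by apply: ler_wpM2r => //; lra.
have -> : f0 = f + (- f1) by rewrite ff addrK.
apply: le_trans (Kfun_add_ge (ltW u0) C1 HC sf (carrierN q1 c1)) _.
rewrite qnormN// mulrAC mulrC; apply: ler_wpM2r; first exact: ltW.
have H2 : t * qnorm A1 f1 <= 2 * Kfun A0 A1 t f by lra.
have H3 := Kfun_quasiconcave p0 p1 u0 ut sf.
have H4 : u * Kfun A0 A1 t f <= t * Kfun A0 A1 u f.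
  by rewrite -ler_pdivlMl// mulrCA mulrA.
have : u * qnorm A1 f1 <= 2 * Kfun A0 A1 u f.
  rewrite -(ler_pM2l t0).
  have : u * (t * qnorm A1 f1) <= u * (2 * Kfun A0 A1 t f) by rewrite ler_pM2l.
  lra.
lra.
Qed.

End CompatibleCouple.

(** * The norm of the R-space *)

(** The norm of [R_space] with an arbitrary function [h] in place of the K-functional. *)
Definition Rnorm (R : realType) (sigma : R) (r q : \bar R) (b a : R -> R)
    (h : R -> R) : \bar R :=
  lqnorm r `]0, +oo[ (fun t =>
    ((t `^ (- rinv r) * (b t / a t))%:E *
     lqnorm q `]t, +oo[ (fun u =>
       (u `^ (- sigma - rinv q) * a u * h u)%:E))%E).

Section RnormBounds.
Context (R : realType) (sigma : R) (r q : \bar R) (b a : R -> R).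
Hypotheses (s0 : 0 < sigma) (r0 : (0 < r)%E) (q0 : (0 < q)%E).
Hypotheses (ha : regvar 0 a) (hb : regvar 0 b).

Let N (t : R) := lqnorm r `]0, t[ (fun s => (s `^ (- rinv r) * (b s / a s))%:E).

Hypothesis N1 : (N 1 < +oo)%E.

Lemma regvar_ratio : regvar 0 (fun s => b s / a s).
Proof. by have := regvarM hb (regvarV ha); rewrite oppr0 addr0. Qed.

Let hba := regvar_ratio.

Lemma lqnorm_powR_split I (h : R -> R) : {in I, forall u, 0 < u} ->
  lqnorm q I (fun u => (u `^ (- sigma - rinv q) * a u * h u)%:E) =
  lqnorm q I (fun u => (u `^ (- rinv q) * (u `^ (- sigma) * a u * h u))%:E).
Proof.
move=> I0; apply: eq_lqnorm => u uI; have u0 := I0 _ uI.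
by rewrite powRD ?(gt_eqF u0) ?implybT// !mulrA (mulrC (u `^ (- sigma))).
Qed.

(** The bound on [h] is [A * min 1 (u / t) ^ (sigma + m)], so [u ^ (- sigma) * a u * h u] decays
    like a power on both sides of [t], and the inner norm is at most a multiple of its size at [t].
    In the outer norm, [s < t] yields [N t], while [s >= t] yields a multiple of [b t / a t], hence
    of [N t] again. *)
Lemma Rnorm_truncated (m : R) : 0 < m -> exists2 C : R, 0 < C &
  forall (A t : R) (h : R -> R), 0 < A -> 0 < t ->
    (forall u, 0 < u ->
       0 <= h u <= A * expR ((sigma + m) * Num.min 0 (ln u - ln t))) ->
    (Rnorm sigma r q b a h <=
       (C * (A * (t `^ (- sigma) * (a t * fine (N t)))))%:E)%E.
Proof.
move=> m0.
(* The decay [4 * e] is spent as [e] on Potter's bound for [a], [e] on the convergence of the inner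
   norm and [2 * e] on [w]; the last part then pays for Potter's bound on [b / a] and for the outer
   norm. *)
have [e ee] : exists e : R, e = Num.min m sigma / 4 by eexists.
have e0 : 0 < e by rewrite ee divr_gt0// lt_min m0.
have em : 4 * e <= m by rewrite ee mulrC divfK// ge_min lexx.
have es : 4 * e <= sigma by rewrite ee mulrC divfK// ge_min lexx orbT.
have [c Hc] := ha.2 _ e0.
have [c' Hc'] := hba.2 _ e0.
have [Cq Cq0 HCq] := lqnorm_log_peak q0 e0.
have [Cr Cr0 HCr] := lqnorm_log_peak r0 e0.
have [C1 C10 HC1] := primitive_ge r0 hba.
have [C2 C21 HC2] := @lqnorm_split R r r0.
have C20 : 0 < C2 by lra.
pose K : R := expR c * Cq.
have K0 : 0 < K by rewrite mulr_gt0 ?expR_gt0.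
pose L : R := C2 * (1 + expR c' * Cr * C1).
have L0 : 0 < L by rewrite mulr_gt0// addr_gt0// !mulr_gt0 ?expR_gt0.
exists (K * L); first by rewrite mulr_gt0.
move=> A t h A0 t0 hh.
have at0 := ha.1 _ t0; have tp : 0 < t `^ (- sigma) by exact: powR_gt0.
pose Z : R := A * (t `^ (- sigma) * a t) * K.
have Z0 : 0 < Z by rewrite /Z !mulr_gt0 ?expR_gt0.
(* This is 1 for [s <= t] and [(t / s) ^ (2 * e)] beyond. *)
pose w (s : R) : R := expR (- (2 * e) * Num.max 0 (ln s - ln t)).
have inner s : 0 < s ->
    (lqnorm q `]s, +oo[ (fun u => (u `^ (- sigma - rinv q) * a u * h u)%:E) <=
    (Z * w s)%:E)%E.
  move=> s1.
  rewrite lqnorm_powR_split; last first.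
    by move=> u; rewrite in_itv/= andbT; exact: lt_trans.
  have k0 : 0 < A * (t `^ (- sigma) * a t) * expR c * w s.
    by rewrite !mulr_gt0 ?expR_gt0.
  apply: (@le_trans _ _ ((A * (t `^ (- sigma) * a t) * expR c * w s)%:E *
     lqnorm q `]s, +oo[ (fun u => (u `^ (- rinv q) *
        expR (- e * `|ln u - ln t|))%:E))%E); last first.
    rewrite (_ : Z * w s = A * (t `^ (- sigma) * a t) * expR c * w s * Cq);
      last by rewrite /Z /K; ring.
    rewrite [in leRHS]EFinM; apply: lee_wpmul2l; first by rewrite lee_fin ltW.
    apply: le_trans (HCq _ t0); apply: lqnorm_mono => // u.
      by rewrite !in_itv/= !andbT; exact: lt_trans.
    by move=> _; rewrite lexx andbT lee_fin mulr_ge0 ?powR_ge0 ?expR_ge0.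
  apply: ge0_lqnorm_scale_le => // u; rewrite in_itv/= andbT => su.
  have u0 : 0 < u by exact: lt_trans su.
  have au := ha.1 _ u0; have up : 0 < u `^ (- sigma) by exact: powR_gt0.
  have /andP[h0 h1] := hh _ u0.
  rewrite mulr_ge0 ?(mulr_ge0 (ltW up) (ltW au))//=.
  apply: le_trans (ler_wpM2l (mulr_ge0 (ltW up) (ltW au)) h1) _.
  rewrite mulrCA -!mulrA ler_pM2l// !mulrA.
  have pw x : 0 < x -> x `^ (- sigma) = expR (- sigma * ln x).
    by move=> x0; rewrite /powR gt_eqF.
  rewrite -[a u]lnK ?posrE// -[a t]lnK ?posrE// !pw// -!expRD ler_expR.
  have := Hc _ _ u0 t0; have lsu : ln s < ln u by rewrite ltr_ln.
  set x := ln u - ln t; rewrite mul0r add0r => Hx.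
  suff : - sigma * ln u + (sigma + m) * Num.min 0 x + e * `|x| <=
      - sigma * ln t + - (2 * e) * Num.max 0 (ln s - ln t) - e * `|x| by lra.
  have M : Num.max 0 (ln s - ln t) <= `|x|.
    rewrite ge_max normr_ge0/=; apply: le_trans (ler_norm _).
    by rewrite /x lerD2r ltW.
  have M2 : 2 * e * Num.max 0 (ln s - ln t) <= 2 * e * `|x|.
    by rewrite ler_pM2l// mulr_gt0.
  suff : - sigma * x + (sigma + m) * Num.min 0 x <= - (4 * e) * `|x|.
    by move: M2; rewrite /x; lra.
  have [x0|x0] := leP 0 x.
    by rewrite ger0_norm// mulr0 addr0 ler_wpM2r// lerN2.
  have : m * x <= 4 * e * x by rewrite ler_nM2r.
  rewrite ltr0_norm//; lra.
have w1 s : w s <= 1.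
  have mx : 0 <= Num.max 0 (ln s - ln t) by rewrite le_max lexx.
  have := mulr_ge0 (ltW e0) mx.
  by rewrite -expR0 ler_expR; lra.
pose g s := ((s `^ (- rinv r) * (b s / a s * w s))%:E : \bar R).
have g0 : {in `]0, +oo[, forall s, (0 <= g s)%E}.
  move=> s; rewrite in_itv/= andbT => s1.
  by rewrite lee_fin !mulr_ge0 ?powR_ge0 ?expR_ge0// ?invr_ge0 ltW// ?ha.1 ?hb.1.
have step1 : (Rnorm sigma r q b a h <= Z%:E * lqnorm r `]0%R, +oo[ g)%E.
  rewrite -lqnorm_scale//; apply: lqnorm_mono => // s; rewrite in_itv/= andbT => s1.
  have P : 0 <= s `^ (- rinv r) * (b s / a s).
    by rewrite mulr_ge0 ?powR_ge0// ltW// hba.1.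
  rewrite mule_ge0 ?lee_fin ?lqnorm_ge0//=.
  apply: le_trans (lee_wpmul2l _ (inner s s1)) _; first by rewrite lee_fin.
  by rewrite -!EFinM lee_fin le_eqVlt; apply/orP; left; apply/eqP; ring.
have bt := hba.1 _ t0.
have step2 : (lqnorm r `]0%R, +oo[ g <= (L * fine (N t))%:E)%E.
  apply: (@le_trans _ _ (C2%:E * (lqnorm r `]0%R, t[ g + lqnorm r `[t, +oo[ g))%E).
    apply: HC2 => // s; rewrite !in_itv/= !andbT => ->/=.
    by case: ltP.
  rewrite /L -mulrA [leRHS]EFinM; apply: lee_wpmul2l; first by rewrite lee_fin ltW.
  rewrite mulrDl mul1r EFinD primitive_fineK//; apply: leeD.
    apply: lqnorm_mono => // s; rewrite in_itv/= => /andP[s1 st].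
    rewrite g0 ?in_itv/= ?s1//= lee_fin ler_wpM2l ?powR_ge0//.
    by rewrite ler_piMr// ltW// hba.1.
  apply: (@le_trans _ _ ((b t / a t * expR c')%:E * lqnorm r `[t, +oo[
     (fun u => (u `^ (- rinv r) * expR (- e * `|ln u - ln t|))%:E))%E).
    apply: ge0_lqnorm_scale_le => //; first by rewrite mulr_gt0 ?expR_gt0.
    move=> s; rewrite in_itv/= andbT => ts.
    have s1 : 0 < s by exact: lt_le_trans ts.
    have bs := hba.1 _ s1.
    rewrite mulr_ge0 ?(ltW bs) ?expR_ge0//=.
    rewrite -[b s / a s]lnK ?posrE// -[b t / a t]lnK ?posrE// -!expRD ler_expR.
    have := Hc' _ _ s1 t0; have lts : ln t <= ln s by rewrite ler_ln.
    rewrite mul0r add0r ger0_norm ?subr_ge0// max_r ?subr_ge0//.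
    lra.
  apply: (@le_trans _ _ ((b t / a t * expR c')%:E * Cr%:E)%E).
    apply: lee_wpmul2l; first by rewrite lee_fin mulr_ge0 ?expR_ge0// ltW.
    apply: le_trans (HCr _ t0); apply: lqnorm_mono => // u.
      by rewrite !in_itv/= !andbT; exact: lt_le_trans.
    by move=> _; rewrite lexx andbT lee_fin mulr_ge0 ?powR_ge0 ?expR_ge0.
  rewrite -EFinM (_ : b t / a t * expR c' * Cr = expR c' * Cr * (b t / a t)); last ring.
  rewrite -[X in (_ <= X)%E](_ : ((expR c' * Cr)%:E * (C1%:E * N t))%E = _); last first.
    have NE : ((fine (N t))%:E = N t)%E := primitive_fineK r0 hba N1 t0.
    by rewrite muleA -EFinM -NE -EFinM.
  rewrite EFinM; apply: lee_wpmul2l; last exact: HC1.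
  by rewrite lee_fin mulr_ge0 ?expR_ge0// ltW.
apply: (le_trans step1); apply: le_trans (lee_wpmul2l _ step2) _.
  by rewrite lee_fin ltW.
rewrite -EFinM lee_fin /Z le_eqVlt; apply/orP; left; apply/eqP; ring.
Qed.

(** For [s < t] the inner norm sees the whole block []t, 2 * t]], where [h] is at least [h t].
    Restricting the outer norm to [s < t] then produces [N t]. *)
Lemma Rnorm_ge : exists2 C : R, 0 < C &
  forall (t : R) (h : R -> R), 0 < t ->
    (forall u v, 0 < u -> u <= v -> 0 <= h u <= h v) ->
    ((t `^ (- sigma) * (a t * fine (N t)) * h t)%:E <=
     C%:E * Rnorm sigma r q b a h)%E.
Proof.
have hs : regvar (- sigma + 0) (fun t => t `^ (- sigma) * a t).
  exact: regvarM (regvar_powR_id _) ha.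
have [C1 C10 HC1] := regvar_comparable hs (ler1n _ 2 : 1 <= 2%:R).
exists (C1 * 2 `^ rinv q); first by rewrite mulr_gt0// powR_gt0.
move=> t h t0 hh; have /andP[ht _] := hh t t t0 (lexx _).
have at0 := ha.1 _ t0; have tp : 0 < t `^ (- sigma) by exact: powR_gt0.
have h0 u : 0 < u -> 0 <= h u by move=> u0; have /andP[] := hh u u u0 (lexx _).
have D0 : 0 < C1 * 2 `^ rinv q by rewrite mulr_gt0// powR_gt0.
move: ht; rewrite le_eqVlt => /predU1P[<-|ht].
  by rewrite mulr0 mule_ge0 ?lqnorm_ge0 ?lee_fin ?(ltW D0).
have [k kE] : exists k : R, k = t `^ (- sigma) * a t * h t by eexists.
have k0 : 0 < k by rewrite kE !mulr_gt0.
have inner s : 0 < s -> s < t -> (k%:E <= (C1 * 2 `^ rinv q)%:E *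
    lqnorm q `]s, +oo[ (fun u => (u `^ (- sigma - rinv q) * a u * h u)%:E))%E.
  move=> s1 st; rewrite lqnorm_powR_split; last first.
    by move=> u; rewrite in_itv/= andbT; exact: lt_trans.
  rewrite EFinM -muleA -lee_pdivrMl// -EFinM.
  apply: (lqnorm_block (t := t)) => //.
  - by rewrite mulr_ge0 ?invr_ge0// ltW.
  - move=> u; rewrite in_itv/= andbT => su.
    have u0 : 0 < u by exact: lt_trans su.
    by rewrite !mulr_ge0 ?powR_ge0 ?h0// ltW// ha.1.
  move=> u /andP[tu u2].
  have u0 : 0 < u by exact: lt_trans tu.
  split; first by rewrite in_itv/= andbT; exact: lt_trans tu.
  rewrite mulrC ler_pdivrMr//; apply: (@le_trans _ _ (C1 * (u `^ (- sigma) * a u) * h t)).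
    rewrite kE ler_pM2r//; apply: HC1 => //; first lra.
  rewrite [leRHS]mulrC -mulrA ler_pM2l//; apply: ler_wpM2l.
    by rewrite mulr_ge0 ?powR_ge0// ltW// ha.1.
  by have /andP[] := hh t u t0 (ltW tu).
rewrite (_ : _ * h t = k * fine (N t)); last by rewrite kE; ring.
rewrite EFinM primitive_fineK// -lqnorm_scale//; last first.
  move=> s; rewrite in_itv/= => /andP[s1 _].
  by rewrite lee_fin mulr_ge0 ?powR_ge0// ltW// hba.1.
rewrite -lqnorm_scale//; last first.
  move=> s; rewrite in_itv/= andbT => s1; rewrite mule_ge0 ?lqnorm_ge0// lee_fin.
  by rewrite mulr_ge0 ?powR_ge0// ltW// hba.1.
apply: lqnorm_mono => // s; first by rewrite !in_itv/= andbT => /andP[].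
rewrite in_itv/= => /andP[s1 st].
have P : 0 <= s `^ (- rinv r) * (b s / a s).
  by rewrite mulr_ge0 ?powR_ge0// ltW// hba.1.
rewrite mule_ge0 ?lee_fin ?(ltW k0)//= muleCA muleC.
by apply: lee_wpmul2l; [rewrite lee_fin|exact: inner].
Qed.

End RnormBounds.

(** * K-functional of the R-space and A1 *)

Section QuasiConcave.
Context (R : realType).
Implicit Types (K F : R -> R) (r : \bar R) (x y : int -> R).

Definition quasiconcave K : Prop :=
  forall s t, 0 < s -> s <= t -> 0 <= K s <= K t /\ K t <= t / s * K s.

(** Only the term [n = 0] of the shifted supremum is used; the ratio 1/2 is arbitrary. *)
Lemma ell_le r (C : R) : (0 < r)%E -> 0 < C -> exists2 C' : R, 0 < C' &
  forall x y, (forall k, 0 <= x k <= C * y k) -> (ell r x <= C'%:E * ell r y)%E.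
Proof.
move=> r0 C0; have h : 0 < (2^-1 : R) < 1 by rewrite invr_gt0 ltr0n/= invf_lt1// ltr1n.
have [C' C'0 H] := ell_shift_sup r0 h C0; exists C' => // x y xy.
apply: H => k; first by have /andP[] := xy k.
  by have /andP[x0 /(le_trans x0)] := xy k; rewrite pmulr_rge0.
move=> s /(_ 0%N); rewrite expr0 mul1r subr0 => ys.
by have /andP[_ /le_trans] := xy k; apply; rewrite ler_pM2l.
Qed.

Lemma le_ell r y k : (0 < r)%E -> (forall k, 0 <= y k) -> ((y k)%:E <= ell r y)%E.
Proof.
move=> r0 y0; rewrite /ell; case: r r0 => [r| |]// r0; last first.
  by apply: ereal_sup_ubound; exists k.
rewrite -[y k in leLHS](powRr1 (y0 k)) -(divff (lt0r_neq0 r0)) powRrM -poweR_EFin.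
have r1 : 0 <= r^-1 by rewrite invr_ge0 ltW.
apply: le_poweR; rewrite ?lee_fin ?powR_ge0//.
rewrite esum_int; last by move=> j; rewrite lee_fin powR_ge0.
have [_ _ /(_ k I) [n _ <-]] := int_of_rank_bij.
apply: (nneseries_ge_term (u := fun n => (y (int_of_rank n) `^ r)%:E)) => i.
by rewrite lee_fin powR_ge0.
Qed.

Lemma cells_comparable alpha F (D : R) : regvar alpha F -> 1 <= D ->
  exists2 C : R, 0 < C & forall v K, cells D v -> quasiconcave K ->
    forall k u, v k < u <= v (k + 1) ->
      F u * K u <= C * (F (v k) * K (v k)) /\
      F (v k) * K (v k) <= C * (F u * K u).
Proof.
move=> hF D1; have [C C0 HC] := regvar_comparable hF D1.
have D0 : 0 < D by lra.
exists (C * D); first by rewrite mulr_gt0.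
move=> v K vD hK k u /andP[ku uk]; have [v0 _ vDv] := vD k.
have u0 : 0 < u by exact: lt_trans ku.
have uD : u <= D * v k by exact: le_trans vDv.
have vu : v k <= D * u by apply: (le_trans (ltW ku)); rewrite ler_peMl// ltW.
have [/andP[K0 Ku] Kv] := hK _ _ v0 (ltW ku).
have Fu := hF.1 _ u0; have Fv := hF.1 _ v0.
split.
  rewrite (_ : C * D * _ = (C * F (v k)) * (D * K (v k))); last ring.
  apply: ler_pM.
  - exact: ltW.
  - exact: le_trans Ku.
  - exact: HC.
  - apply: (le_trans Kv); apply: ler_wpM2r => //.
    by rewrite ler_pdivrMr.
rewrite (_ : C * D * _ = (C * F u) * (D * K u)); last ring.
apply: ler_pM => //.
- exact: ltW.
- exact: HC.
- apply: (le_trans Ku); rewrite ler_peMl//; exact: le_trans Ku.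
Qed.

(** On a cell, Potter's bound controls [F] and quasi-concavity controls [K]. The constant is chosen
    before [v] and [K], so it is uniform over all vectors. *)
Lemma lqnorm_equiv_ell r alpha F (D : R) : (0 < r)%E -> regvar alpha F -> 1 <= D ->
  exists2 C : R, 0 < C & forall v K, cells D v -> quasiconcave K ->
    (lqnorm r `]0%R, +oo[ (fun u => (u `^ (- rinv r) * (F u * K u))%:E) <=
      C%:E * ell r (fun k => (F (v k) * K (v k))%R))%E /\
    (ell r (fun k => (F (v k) * K (v k))%R) <=
      C%:E * lqnorm r `]0%R, +oo[ (fun u => (u `^ (- rinv r) * (F u * K u))%:E))%E.
Proof.
move=> r0 hF D1; have [C C0 HC] := cells_comparable hF D1.
have [C' C'0 HC'] := ell_le r0 C0.
have D0 : 0 < D by lra.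
pose E : R := Num.max (D `^ rinv r * C') (C' * 2 `^ rinv r).
exists E; first by rewrite /E lt_max mulr_gt0// powR_gt0.
move=> v K vD hK; have H := HC v K vD hK.
have FK0 u : 0 < u -> 0 <= F u * K u.
  move=> u0; have [/andP[K0 _] _] := hK u u u0 (lexx _).
  by rewrite mulr_ge0// ltW// hF.1.
pose y k : R := F (v k) * K (v k).
have y0 k : 0 <= y k by apply: FK0; exact: cells_gt0 vD k.
have u0 k u : v k < u <= v (k + 1) -> 0 < u.
  by move=> /andP[+ _]; apply: lt_trans; exact: cells_gt0 vD k.
split.
  apply: (@le_trans _ _ ((D `^ rinv r)%:E * ell r (fun k => C * y k)%R)%E).
    apply: lqnorm_le_ell => // k u ku; rewrite FK0 ?(u0 _ _ ku)//=.
    by have [] := H k u ku.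
  apply: (@le_trans _ _ ((D `^ rinv r)%:E * (C'%:E * ell r y))%E).
    apply: lee_wpmul2l; first by rewrite lee_fin powR_ge0.
    by apply: HC' => k; rewrite lexx andbT mulr_ge0// ltW.
  rewrite muleA -EFinM; apply: lee_wpmul2r.
    by apply: le_trans (le_ell 0 r0 y0); rewrite lee_fin.
  by rewrite lee_fin /E le_max lexx.
apply: (@le_trans _ _ (C'%:E * ell r (fun k => C^-1 * y k)%R)%E).
  by apply: HC' => k; rewrite y0/= mulrA divff ?gt_eqF// mul1r.
apply: (@le_trans _ _ (C'%:E * ((2 `^ rinv r)%:E * lqnorm r `]0%R, +oo[
    (fun u => (u `^ (- rinv r) * (F u * K u))%:E)))%E).
  apply: lee_wpmul2l; first by rewrite lee_fin ltW.
  apply: (ell_le_lqnorm r0 vD) => [k|k u ku].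
    by rewrite mulr_ge0// invr_ge0 ltW.
  by rewrite ler_pdivrMl//; have [] := H k u ku.
rewrite muleA -EFinM; apply: lee_wpmul2r; first exact: lqnorm_ge0.
by rewrite lee_fin /E le_max lexx orbT.
Qed.

Lemma regvar_cells alpha F : 0 < alpha -> regvar alpha F ->
  exists L D : R, [/\ 0 < L, 1 <= D,
    cells D (fun k : int => expR (L * k%:~R)) &
    cells D (fun k : int => F (expR (L * k%:~R)))].
Proof.
move=> al0 hF; have a2 : 0 < alpha / 2 by rewrite divr_gt0.
have [c Hc] := hF.2 _ a2.
have l2 : 0 < ln 2 :> R by rewrite ln_gt0// ltr1n.
(* Potter's bound with error [alpha / 2] makes [ln F] grow by at least [L * alpha / 2 - c] over one
   step, and this choice makes that at least [ln 2]. *)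
pose L : R := Num.max (2 * (c + ln 2) / alpha) (ln 2).
have L2 : ln 2 <= L by rewrite /L le_max lexx orbT.
have Lc : 2 * (c + ln 2) <= L * alpha by rewrite -ler_pdivrMr// /L le_max lexx.
have L0 : 0 < L by lra.
have eL : 1 <= expR L by rewrite -expR0 ler_expR ltW.
have [C C0 HC] := regvar_comparable hF eL.
exists L, (Num.max (expR L) C).
have E k : expR (L * (k + 1)%:~R) = expR L * expR (L * k%:~R).
  by rewrite intrD mulrDr mulr1 expRD mulrC.
split=> //.
- by rewrite le_max eL.
- move=> k; rewrite E; split.
  + exact: expR_gt0.
  + by rewrite ler_pM2r ?expR_gt0// -[2]lnK ?posrE// ler_expR.
  + by rewrite ler_pM2r ?expR_gt0// le_max lexx.
move=> k; rewrite E; set t := expR (L * _).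
have t0 : 0 < t by exact: expR_gt0.
have Mt0 : 0 < expR L * t by rewrite mulr_gt0 ?expR_gt0.
have Ft := hF.1 _ t0; have FMt := hF.1 _ Mt0.
split=> //.
  rewrite -ler_ln ?posrE ?mulr_gt0// lnM ?posrE//.
  have := Hc _ _ t0 Mt0; rewrite lnM ?posrE ?expR_gt0// expRK.
  rewrite (_ : ln t - (L + ln t) = - L); last ring.
  rewrite normrN gtr0_norm//; nra.
apply: (@le_trans _ _ (C * F t)).
  apply: HC => //; rewrite mulrA ler_peMl ?(ltW t0)//.
  exact: mulr_ege1.
by rewrite ler_pM2r// le_max lexx orbT.
Qed.

End QuasiConcave.

(** * Holmstedt-type estimates for the R-space and A1 *)

Section Holmstedt.
Context (R : realType) (V : topologicalLmodType R) (A0 A1 : qspace V).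
Context (th0 : R) (q0 r0 : \bar R) (a0 b0 : R -> R).
Hypotheses (cA : compatible_couple A0 A1) (th0_01 : 0 < th0 < 1).
Hypotheses (q0_gt0 : (0 < q0)%E) (r0_gt0 : (0 < r0)%E).
Hypotheses (ha0 : regvar 0 a0) (hb0 : regvar 0 b0).

Let N (t : R) := lqnorm r0 `]0, t[ (fun s => (s `^ (- rinv r0) * (b0 s / a0 s))%:E).
Hypothesis N1 : (N 1 < +oo)%E.

Let c0 (t : R) : R := a0 t * fine (N t).
Let rho (t : R) : R := t `^ (1 - th0) * c0 t.
Let X := R_space A0 A1 th0 r0 b0 q0 a0.

Let th0_gt0 : 0 < th0. Proof. by case/andP: th0_01. Qed.
Let q_A0 : quasi_banach A0. Proof. by case: cA. Qed.
Let q_A1 : quasi_banach A1. Proof. by case: cA. Qed.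

Lemma regvar_c0 : regvar 0 c0.
Proof.
rewrite -[0]addr0; apply: regvarM => //.
by apply: primitive_regvar => //; exact: regvar_ratio.
Qed.

Lemma regvar_rho : regvar (1 - th0) rho.
Proof.
by rewrite -[1 - th0]addr0; apply: regvarM regvar_c0; exact: regvar_powR_id.
Qed.

Lemma qnorm_R_space_ge0 f : carrier X f -> 0 <= qnorm X f.
Proof. by move=> _; apply: fine_ge0; exact: lqnorm_ge0. Qed.

Lemma sum_R_space f : sum_space X A1 f -> sum_space A0 A1 f.
Proof.
move=> [g [h [[[f0 [f1 [c c1 ->]]] _] ch ->]]].
by exists f0, (f1 + h); rewrite addrA; split=> //; exact: qb_add.
Qed.

Lemma quasiconcave_Kfun f : sum_space A0 A1 f ->
  quasiconcave (fun t => Kfun A0 A1 t f).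
Proof.
have p0 := qb_ge0 q_A0; have p1 := qb_ge0 q_A1.
move=> sf s t s0 st; rewrite Kfun_ge0 ?(ltW s0)//= Kfun_mono ?(ltW s0)//.
by split=> //; exact: Kfun_quasiconcave.
Qed.

Lemma quasiconcave_Kfun_R_space f : sum_space X A1 f ->
  quasiconcave (fun t => Kfun X A1 t f).
Proof.
have p0 := qnorm_R_space_ge0; have p1 := qb_ge0 q_A1.
move=> sf s t s0 st; rewrite Kfun_ge0 ?(ltW s0)//= Kfun_mono ?(ltW s0)//.
by split=> //; exact: Kfun_quasiconcave.
Qed.

(** For [f = g + h] with [g] in [X] and [h] in [A1], [Rnorm_ge] bounds the contribution of [g] by
    its norm in [X]. That of [h] is at most [t ^ (- th0) * c0 t * t = rho t] times its norm, up to a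
    constant. *)
Lemma Kfun_R_space_ge : exists2 C : R, 0 < C &
  forall t f, 0 < t -> sum_space X A1 f ->
    t `^ (- th0) * c0 t * Kfun A0 A1 t f <= C * Kfun X A1 (rho t) f.
Proof.
have [C C0 HC] := Rnorm_ge th0 r0_gt0 q0_gt0 ha0 hb0 N1.
have [C1 C11 HC1] := qb_triangle q_A1.
have C10 : 0 < C1 by lra.
exists (C1 * (C + 1)); first by rewrite mulr_gt0// addr_gt0.
move=> t f t0 sf.
rewrite -ler_pdivrMl ?mulr_gt0 ?addr_gt0//; apply: Kfun_ge => // g h cg ch ->.
rewrite ler_pdivrMl ?mulr_gt0 ?addr_gt0//.
have [sg Ng] := cg.
pose p : R := t `^ (- th0) * c0 t.
have ct := regvar_c0.1 _ t0.
have p0 : 0 < p by rewrite /p mulr_gt0// powR_gt0.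
have Kg : p * Kfun A0 A1 t g <= C * qnorm X g.
  rewrite -lee_fin EFinM [in leRHS]EFinM.
  rewrite [X in (_ <= _ * X)%E](_ : _ =
    Rnorm th0 r0 q0 b0 a0 (fun u => Kfun A0 A1 u g)); last first.
    by rewrite /X /= fineK// ge0_fin_numE//; exact: lqnorm_ge0.
  rewrite -EFinM; apply: HC => // u v u0 uv.
  by have [] := quasiconcave_Kfun sg u0 uv.
have ng := qnorm_R_space_ge0 cg; have nh := qb_ge0 q_A1 ch.
have rp : rho t = p * t.
  rewrite /rho /p mulrAC -[X in _ = _ * X * _](powRr1 (ltW t0)) -powRD; last first.
    by rewrite (gt_eqF t0) implybT.
  by rewrite addrC.
apply: (@le_trans _ _ (p * (C1 * (Kfun A0 A1 t g + t * qnorm A1 h)))).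
  by rewrite ler_pM2l//; apply: Kfun_add_ge => //; exact: ltW.
rewrite mulrCA -[leRHS]mulrA ler_pM2l// mulrDr mulrA -rp.
have rt : 0 <= rho t * qnorm A1 h by rewrite mulr_ge0// ltW// regvar_rho.1.
apply: le_trans (lerD Kg (lexx _)) _.
have : 0 <= C * (rho t * qnorm A1 h) by rewrite mulr_ge0// ltW.
lra.
Qed.

(** The hypothesis on K loses [(t / u) ^ m] and Potter's bound for [psi] loses as much, so of the
    exponent [eta = th0 + 3 * m] there remains K(u, f) at most a multiple of
    [(s / psi t) * (u / t) ^ (th0 + m)]. This is the decay that [Rnorm_truncated] asks of the
    truncated part [f0]. As [f] is taken in A0 + A1 only, membership of [f] in X + A1 comes out as
    well. *)
Lemma R_space_decomposition (eta m : R) (psi : R -> R) : 0 < m ->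
  regvar (- eta) psi -> eta = th0 + 3 * m ->
  exists2 C : R, 0 < C & forall t f s, 0 < t -> 0 < s -> sum_space A0 A1 f ->
    (forall u, 0 < u -> u <= t ->
       psi u * Kfun A0 A1 u f <= s * expR (m * (ln t - ln u))) ->
    exists f0 f1, [/\ carrier X f0, carrier A1 f1, f = f0 + f1 &
      psi t * (qnorm X f0 + rho t * qnorm A1 f1) <=
        C * (t `^ (- th0) * c0 t * s)].
Proof.
move=> m0 hpsi eta_m.
have p0 := qb_ge0 q_A0; have p1 := qb_ge0 q_A1.
have [C C0 HC] := Rnorm_truncated th0_gt0 r0_gt0 q0_gt0 ha0 hb0 N1 m0.
have [C1 C10 HC1] := Kfun_truncation cA.
have [c Hc] := hpsi.2 _ m0.
exists (C * C1 * expR c + 2); first by rewrite addr_gt0 ?mulr_gt0 ?expR_gt0.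
move=> t f s t0 s0 sf Hs.
have [f0 [f1 [cf0 cf1 ff Kf Kf0]]] := HC1 t f t0 sf.
have pt := hpsi.1 _ t0; have ct := regvar_c0.1 _ t0.
have tp : 0 < t `^ (- th0) by exact: powR_gt0.
have sf0 : sum_space A0 A1 f0 by exact: sum_space_carrierl.
have Ku u : 0 < u -> u <= t -> Kfun A0 A1 u f <=
    s / psi t * expR c * expR ((th0 + m) * (ln u - ln t)).
  move=> u0 ut; have pu := hpsi.1 _ u0.
  have lut : ln u <= ln t by rewrite ler_ln.
  have h := Hs _ u0 ut.
  have h2 := Hc _ _ t0 u0.
  rewrite ger0_norm ?subr_ge0// in h2.
  have h3 : psi t <= psi u * expR (c - (th0 + 2 * m) * (ln t - ln u)).
    rewrite -ler_ln ?posrE ?mulr_gt0 ?expR_gt0// lnM ?posrE ?expR_gt0// expRK.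
    move: h2; rewrite eta_m; lra.
  rewrite -(ler_pM2l pt).
  have K0 : 0 <= Kfun A0 A1 u f by apply: Kfun_ge0 => //; exact: ltW.
  apply: le_trans (ler_wpM2r K0 h3) _.
  rewrite mulrAC; apply: le_trans (ler_wpM2r (expR_ge0 _) h) _.
  set E3 := expR ((th0 + m) * _).
  have -> : psi t * (s / psi t * expR c * E3) = s * (expR c * E3).
    by field; rewrite gt_eqF.
  rewrite -mulrA ler_pM2l// -!expRD ler_expR; lra.
pose A : R := C1 * (s / psi t * expR c).
have A_gt0 : 0 < A by rewrite /A !mulr_gt0 ?expR_gt0 ?invr_gt0.
have NX := HC A t (fun u => Kfun A0 A1 u f0) A_gt0 t0.
have {}NX : (Rnorm th0 r0 q0 b0 a0 (fun u => Kfun A0 A1 u f0) <=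
   (C * (A * (t `^ (- th0) * c0 t)))%:E)%E.
  apply: NX => u u0; rewrite Kfun_ge0 ?(ltW u0)//=.
  apply: (le_trans (Kf0 u u0)); rewrite /A -!mulrA ler_pM2l// !mulrA.
  have [ut|tu] := leP u t.
    have lut : ln u <= ln t by rewrite ler_ln.
    by rewrite min_r ?subr_le0//; exact: Ku.
  have ltu : ln t < ln u by rewrite ltr_ln.
  rewrite min_l ?subr_ge0 ?(ltW ltu)//.
  by have := Ku t t0 (lexx _); rewrite subrr.
have cX : carrier X f0 by split=> //; apply: le_lt_trans NX _; rewrite ltry.
exists f0, f1; split=> //.
have nX : qnorm X f0 <= C * (A * (t `^ (- th0) * c0 t)).
  rewrite -lee_fin; apply: le_trans NX; rewrite /X/= fineK//.
  by rewrite ge0_fin_numE; [exact: cX.2|exact: lqnorm_ge0].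
have nf1 : t * qnorm A1 f1 <= 2 * Kfun A0 A1 t f by have := p0 _ cf0; lra.
have Kt := Hs t t0 (lexx _).
rewrite subrr mulr0 expR0 mulr1 in Kt.
have rp : rho t = t `^ (- th0) * c0 t * t.
  rewrite /rho mulrAC -[X in _ = _ * X * _](powRr1 (ltW t0)) -powRD; last first.
    by rewrite (gt_eqF t0) implybT.
  by rewrite addrC.
pose p : R := t `^ (- th0) * c0 t.
have p_gt0 : 0 < p by rewrite mulr_gt0.
rewrite rp -/p mulrDr mulrDl; apply: lerD.
  apply: (@le_trans _ _ (psi t * (C * (A * p)))); first by rewrite ler_pM2l.
  rewrite /A le_eqVlt; apply/orP; left; apply/eqP; field.
  by rewrite gt_eqF.
apply: (@le_trans _ _ (psi t * (p * (2 * Kfun A0 A1 t f)))).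
  by rewrite ler_pM2l// -mulrA ler_pM2l.
rewrite (_ : _ * _ = 2 * p * (psi t * Kfun A0 A1 t f)); last ring.
by rewrite [leRHS]mulrA ler_pM2l// mulr_gt0.
Qed.

End Holmstedt.

(** * Equivalence of the two interpolation norms *)

Lemma le_int_nat (j k : int) : j <= k -> exists n : nat, k = j + n%:Z.
Proof. by move=> jk; exists `|k - j|%N; lia. Qed.

Theorem theorem22 (R : realType) (V : topologicalLmodType R)
    (A0 A1 : qspace V) (theta0 theta : R) (q0 r r0 : \bar R)
    (a a0 b0 : R -> R) :
  compatible_couple A0 A1 ->
  carrier A0 `&` carrier A1 <> [set 0] ->
  0 < theta0 < 1 ->
  0 < theta <= 1 ->
  (0 < q0)%E -> (0 < r)%E -> (0 < r0)%E ->
  SV a -> SV a0 -> SV b0 ->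
  (lqnorm r0 `]0%R, 1%R[ (fun s => (s `^ (- rinv r0) * (b0 s / a0 s))%:E)
     < +oo)%E ->
  (theta = 1 ->
     (lqnorm r `]0%R, 1%R[ (fun s => (s `^ (- rinv r) * a s)%:E) < +oo)%E) ->
  let c0 (t : R) : R := a0 t *
    fine (lqnorm r0 `]0%R, t[
            (fun s => (s `^ (- rinv r0) * (b0 s / a0 s))%:E)) in
  let rho (t : R) : R := t `^ (1 - theta0) * c0 t in
  let eta : R := (1 - theta) * theta0 + theta in
  let asharp (t : R) : R := c0 t `^ (1 - theta) * a (rho t) in
  same_space
    (interp_space (R_space A0 A1 theta0 r0 b0 q0 a0) A1 theta r a)
    (interp_space A0 A1 eta r asharp).
Proof.
move=> cA _ th0 /andP[th_gt0 th_le1] q0_gt0 r_gt0 r0_gt0 /SV_regvar ha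
  /SV_regvar ha0 /SV_regvar hb0 N1 _ c0 rho eta asharp.
set X := R_space _ _ _ _ _ _ _.
have /andP[th0_gt0 th0_lt1] := th0.
have hc0 : regvar 0 c0 := regvar_c0 r0_gt0 ha0 hb0 N1.
have hrho : regvar (1 - theta0) rho := regvar_rho theta0 r0_gt0 ha0 hb0 N1.
pose phi (v : R) : R := v `^ (- theta) * a v.
have hphi : regvar (- theta + 0) phi := regvarM (regvar_powR_id _) ha.
pose psi (t : R) : R := t `^ (- eta) * asharp t.
(* The weights of the two norms differ by exactly the factor of the Holmstedt estimates. *)
have psiE t : 0 < t -> psi t = phi (rho t) * (t `^ (- theta0) * c0 t).
  move=> t0; have ct := hc0.1 _ t0; have tp x : 0 < t `^ x by exact: powR_gt0.
  rewrite /psi /asharp /phi /rho powRM ?(ltW (tp _)) ?(ltW ct)// -powRrM.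
  have -> : - eta = (1 - theta0) * - theta + - theta0 by rewrite /eta; ring.
  rewrite powRD ?(gt_eqF t0) ?implybT// addrC powRD ?(gt_eqF ct) ?implybT//.
  by rewrite powRr1 ?(ltW ct)//; ring.
have hpsi : regvar (- eta) psi.
  have -> : - eta = (- theta + 0) * (1 - theta0) + (- theta0 + 0).
    by rewrite /eta; ring.
  apply: (@eq_regvar _ _ (fun t => phi (rho t) * (t `^ (- theta0) * c0 t))).
    by move=> t /psiE.
  apply: regvarM (regvar_comp hrho hphi) _.
  exact: regvarM (regvar_powR_id _) hc0.
(* With M = [expR L], the left norm is sampled at rho(M^k) and the right norm at M^k, with the same
   index [k]. *)
have [|L [D [L_gt0 D_ge1 vD rvD]]] := regvar_cells _ hrho; first by rewrite subr_gt0.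
pose v (k : int) : R := expR (L * k%:~R).
have v_gt0 k : 0 < v k by exact: expR_gt0.
pose x f (k : int) : R := phi (rho (v k)) * Kfun X A1 (rho (v k)) f.
pose y f (k : int) : R := psi (v k) * Kfun A0 A1 (v k) f.
pose NL f := lqnorm r `]0%R, +oo[ (fun u =>
  (u `^ (- theta - rinv r) * a u * Kfun X A1 u f)%:E).
pose NR f := lqnorm r `]0%R, +oo[ (fun u =>
  (u `^ (- eta - rinv r) * asharp u * Kfun A0 A1 u f)%:E).
have [C1 C1_gt0 HC1] := lqnorm_equiv_ell r_gt0 hphi D_ge1.
have [C2 C2_gt0 HC2] := lqnorm_equiv_ell r_gt0 hpsi D_ge1.
have qcX f : sum_space X A1 f -> quasiconcave (fun t => Kfun X A1 t f).
  exact: quasiconcave_Kfun_R_space.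
have qcA f : sum_space A0 A1 f -> quasiconcave (fun t => Kfun A0 A1 t f).
  exact: quasiconcave_Kfun.
have pos : {in `]0, +oo[, forall u : R, 0 < u}.
  by move=> u; rewrite in_itv/= andbT.
have NLx f : sum_space X A1 f ->
    (NL f <= C1%:E * ell r (x f))%E /\ (ell r (x f) <= C1%:E * NL f)%E.
  move=> sf; rewrite /NL lqnorm_powR_split//.
  exact: HC1 _ _ rvD (qcX f sf).
have NRy f : sum_space A0 A1 f ->
    (NR f <= C2%:E * ell r (y f))%E /\ (ell r (y f) <= C2%:E * NR f)%E.
  move=> sf; rewrite /NR lqnorm_powR_split//.
  exact: HC2 _ _ vD (qcA f sf).
have x_ge0 f k : sum_space X A1 f -> 0 <= x f k.
  move=> sf; have rv := hrho.1 _ (v_gt0 k).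
  have [/andP[K0 _] _] := qcX f sf _ _ rv (lexx _).
  by rewrite mulr_ge0// ltW// hphi.1.
have y_ge0 f k : sum_space A0 A1 f -> 0 <= y f k.
  move=> sf; have [/andP[K0 _] _] := qcA f sf _ _ (v_gt0 k) (lexx _).
  by rewrite mulr_ge0// ltW// hpsi.1.
split.
- have [C3 C3_gt0 HC3] := Kfun_R_space_ge theta0 cA q0_gt0 r0_gt0 ha0 hb0 N1.
  have [C4 C4_gt0 HC4] := ell_le r_gt0 C3_gt0.
  (* This direction is termwise: [y f k <= C3 * x f k] by [Kfun_R_space_ge] and [psiE]. *)
  have yx f : sum_space X A1 f -> (NR f <= (C2 * (C4 * C1))%:E * NL f)%E.
    move=> sf; have sA := sum_R_space cA sf.
    have [NRle _] := NRy f sA; have [_ NLge] := NLx f sf.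
    apply: (le_trans NRle); rewrite EFinM -muleA; apply: lee_wpmul2l.
      by rewrite lee_fin ltW.
    apply: (@le_trans _ _ (C4%:E * ell r (x f))%E).
      apply: HC4 => k; rewrite y_ge0//= /y /x psiE// -mulrA [leRHS]mulrCA.
      rewrite ler_pM2l; last by rewrite hphi.1// hrho.1.
      exact: HC3.
    rewrite EFinM -muleA; apply: lee_wpmul2l => //.
    by rewrite lee_fin ltW.
  have C_gt0 : 0 < C2 * (C4 * C1) by rewrite !mulr_gt0.
  have fin f : sum_space X A1 f -> (NL f < +oo)%E -> (NR f < +oo)%E.
    move=> sf Nf; apply: le_lt_trans (yx f sf) _.
    by rewrite lte_mul_pinfty// lee_fin ltW.
  split=> [f [sf Nf]|].
    by split; [exact: sum_R_space sf|exact: fin].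
  exists (C2 * (C4 * C1)) => // f [sf Nf] /=.
  rewrite -/(NL f) -/(NR f) -lee_fin EFinM.
  rewrite !fineK ?ge0_fin_numE ?lqnorm_ge0 ?fin//.
  exact: yx.
(* The gap eta - theta0 = theta (1 - theta0) is shared between the growth rate
   of psi K, the Potter loss for psi, and the decay left over in X. *)
pose m : R := theta * (1 - theta0) / 3.
have m_gt0 : 0 < m by rewrite /m !mulr_gt0 ?subr_gt0// invr_gt0.
have eta_m : eta = theta0 + 3 * m by rewrite /eta /m; field.
have [C3 C3_gt0 HC3] :=
  R_space_decomposition cA th0 q0_gt0 r0_gt0 ha0 hb0 N1 m_gt0 hpsi eta_m.
have [C4 C4_gt0 HC4] := cells_comparable hpsi D_ge1.
(* Thus [d ^+ n] is [(v (k - n) / v k) ^ m]. *)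
pose d : R := expR (- (m * L)).
have d01 : 0 < d < 1 by rewrite expR_gt0 expR_lt1 oppr_lt0 mulr_gt0.
(* Bounds at the points [v (k - n)] extend to all [u <= v k]: comparability on the cell of [u] costs
   [C4], and the distance from its left end to [u] costs at most one step, [expR (m * L)]. *)
have decomp f k s : sum_space A0 A1 f -> 0 < s ->
    (forall n : nat, d ^+ n * y f (k - n%:Z) <= s) ->
    exists f0 f1, [/\ carrier X f0, carrier A1 f1, f = f0 + f1 &
      phi (rho (v k)) * (qnorm X f0 + rho (v k) * qnorm A1 f1) <=
        C3 * (C4 * expR (m * L)) * s].
  move=> sf s0 Hs.
  have S0 : 0 < C4 * expR (m * L) * s by rewrite !mulr_gt0 ?expR_gt0.
  have [|f0 [f1 [cf0 cf1 ff H]]] := HC3 (v k) f _ (v_gt0 k) S0 sf.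
    move=> u u0 uk; have [j /andP[ju uj]] := cells_cover vD u0.
    have jk : (j < k)%R.
      have : v j < v k by exact: lt_le_trans uk.
      by rewrite /v ltr_expR ltr_pM2l// ltr_int.
    have ju1 : v j < u <= v (j + 1) by rewrite ju.
    have [Fu _] := HC4 _ _ vD (qcA f sf) j u ju1.
    apply: (le_trans Fu).
    rewrite -[_ * s * _]mulrA -[C4 * _ * _]mulrA ler_pM2l//.
    have [n kn] := le_int_nat (ltW jk).
    have := Hs n; rewrite kn addrK.
    rewrite /d -expRM_natl mulrN expRN ler_pdivrMl ?expR_gt0// => Hj.
    apply: (le_trans Hj); rewrite [leRHS]mulrCA [leLHS]mulrC ler_pM2l// -expRD ler_expR.
    rewrite expRK; have : ln u <= L * (j + 1)%:~R.
      by rewrite -[leRHS]expRK ler_ln// posrE expR_gt0.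
    rewrite [(j + n%:Z)%:~R]intrD -[n%:Z%:~R]/(n%:R : R).
    rewrite intrD => h.
    have : m * ln u <= m * (L * (j%:~R + 1%:~R)) by rewrite ler_pM2l.
    lra.
  exists f0, f1; split=> //.
  have tp : 0 < v k `^ (- theta0) * c0 (v k).
    by rewrite mulr_gt0 ?powR_gt0// hc0.1.
  rewrite -(ler_pM2l tp); move: H; rewrite psiE// -/(c0 _) -/(rho _).
  move: (_ `^ _ * _) (qnorm _ _ + _) => p Q; lra.
have P_gt0 : 0 < C3 * (C4 * expR (m * L)) by rewrite !mulr_gt0 ?expR_gt0.
have [C5 C5_gt0 HC5] := ell_shift_sup r_gt0 d01 P_gt0.
have fin_sum f : sum_space A0 A1 f -> (NR f < +oo)%E -> sum_space X A1 f.
  move=> sf Nf; have [_ yN] := NRy f sf.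
  have yfin : (ell r (y f) < +oo)%E.
    by apply: (le_lt_trans yN); rewrite lte_mul_pinfty// lee_fin ltW.
  have yle k : y f k <= fine (ell r (y f)).
    have H := le_ell k r_gt0 (fun k => y_ge0 f k sf).
    rewrite -lee_fin fineK// ge0_fin_numE//; apply: le_trans H.
    by rewrite lee_fin y_ge0.
  (* Adding 1 keeps the bound positive, as [decomp] requires, even when the norm is 0. *)
  have s0 : 0 < fine (ell r (y f)) + 1.
    by rewrite ltr_wpDl//; apply: le_trans (yle 0); exact: y_ge0.
  have [|f0 [f1 [cf0 cf1 ff _]]] := decomp f 0 _ sf s0.
    move=> n; apply: (@le_trans _ _ (y f (0 - n%:Z))).
      rewrite ler_piMl ?y_ge0// exprn_ile1//; case/andP: d01 => h1 h2; exact: ltW.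
    by apply: (le_trans (yle _)); rewrite lerDl.
  by exists f0, f1.
have xy f : sum_space A0 A1 f -> sum_space X A1 f ->
    (NL f <= (C1 * (C5 * C2))%:E * NR f)%E.
  move=> sA sX; have [NLle _] := NLx f sX; have [_ NRge] := NRy f sA.
  apply: (le_trans NLle); rewrite EFinM -muleA; apply: lee_wpmul2l.
    by rewrite lee_fin ltW.
  apply: (@le_trans _ _ (C5%:E * ell r (y f))%E); last first.
    rewrite EFinM -muleA; apply: lee_wpmul2l => //.
    by rewrite lee_fin ltW.
  apply: HC5 => [k|k|k s Hs]; [exact: x_ge0|exact: y_ge0|].
  (* Here [s] may be 0, so [decomp] is applied to [s + e'], with [e'] chosen to cost exactly [e]. *)
  apply/ler_addgt0Pr => e e_gt0.
  have s_ge0 : 0 <= s.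
    by have := Hs 0%N; apply: le_trans; rewrite mul1r y_ge0.
  pose e' : R := e / (C3 * (C4 * expR (m * L))).
  have e'_gt0 : 0 < e' by rewrite divr_gt0.
  have [|f0 [f1 [cf0 cf1 ff H]]] := decomp f k (s + e') sA (ltr_wpDl s_ge0 e'_gt0).
    by move=> n; apply: (le_trans (Hs n)); rewrite lerDl ltW.
  have rv := hrho.1 _ (v_gt0 k).
  apply: (@le_trans _ _ (phi (rho (v k)) *
      (qnorm X f0 + rho (v k) * qnorm A1 f1))).
    rewrite /x ff ler_pM2l ?hphi.1//; apply: Kfun_le => //; last exact: ltW.
      by move=> g; exact: qnorm_R_space_ge0.
    by case: cA => _ _ + _ _; exact: qb_ge0.
  apply: (le_trans H); rewrite mulrDr lerD2l /e'.
  by rewrite mulrCA divff ?mulr1 ?gt_eqF.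
have C_gt0 : 0 < C1 * (C5 * C2) by rewrite !mulr_gt0.
have fin f : sum_space A0 A1 f -> (NR f < +oo)%E -> (NL f < +oo)%E.
  move=> sf Nf; apply: le_lt_trans (xy f sf (fin_sum f sf Nf)) _.
  by rewrite lte_mul_pinfty// lee_fin ltW.
split=> [f [sf Nf]|].
  by split; [exact: fin_sum|exact: fin].
exists (C1 * (C5 * C2)) => // f [sf Nf] /=.
rewrite -/(NL f) -/(NR f) -lee_fin EFinM.
rewrite !fineK ?ge0_fin_numE ?lqnorm_ge0 ?fin//.
by apply: xy => //; exact: fin_sum.
Qed.
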